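(* Let $d\ge1$, $s>0$, $M\in\mathrm{GL}_d(\mathbb{R})$, and $\mathsf{H}=\{f\in\mathcal{S}(\mathbb{R}^d):\widehat f\in C_c^\infty(\mathbb{R}^d)\}$. Then $(M\mathbb{Z}^d,M\mathbb{Z}^d)$ is a non-uniqueness pair for $(-\Delta)^s$ in $\mathsf{H}$; that is, there exists a nonzero $f\in\mathsf{H}$ such that $f(Mk)=0$ and $(-\Delta)^sf(Mk)=0$ for every $k\in\mathbb{Z}^d$.
   Context: $\mathcal{S}(\mathbb{R}^d)$ is the Schwartz space of complex-valued functions. The Fourier transform is $\widehat f(\xi)=\int_{\mathbb{R}^d}f(x)e^{-2\pi i\xi\cdot x}\,dx$. For $s>0$ and $f\in\mathcal{S}(\mathbb{R}^d)$, $(-\Delta)^sf$ is the smooth function defined by $\widehat{(-\Delta)^sf}(\xi)=|\xi|^{2s}\widehat f(\xi)$. *)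

(* Defs.v *)
From HB Require Import structures.
From mathcomp Require Import all_boot all_order all_algebra.
From mathcomp Require Import all_classical all_reals all_analysis.
From mathcomp Require Import complex.

Set Implicit Arguments.
Unset Strict Implicit.
Unset Printing Implicit Defensive.

Import Order.TTheory GRing.Theory Num.Theory.
Import numFieldNormedType.Exports.

Local Open Scope classical_set_scope.
Local Open Scope ring_scope.
Local Open Scope complex_scope.

Section lebesgue_tuple.
Context {R : realType}.

Definition tcons n (p : measurableTypeR R * n.-tuple R) : n.+1.-tuple R :=
  [tuple of p.1 :: p.2].

Definition tuncons n (t : n.+1.-tuple R) : measurableTypeR R * n.-tuple R :=
  (thead t, [tuple of behead t]).

Lemma tconsK n : cancel (@tcons n) (@tuncons n).
Proof. by case=> x t; congr pair; apply: val_inj. Qed.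

Lemma measurable_tcons n : measurable_fun setT (@tcons n).
Proof. by apply: measurable_cons => //; exact: measurable_snd. Qed.

Lemma measurable_tuncons n : measurable_fun setT (@tuncons n).
Proof.
by apply: measurable_fun_pair; [exact: measurable_tnth|exact: measurable_behead].
Qed.

Section lebesgue_tupleS.
Variables (n : nat) (mu : {sigma_finite_measure set (n.-tuple R) -> \bar R}).

Definition lebesgue_tupleS : set (n.+1.-tuple R) -> \bar R :=
  pushforward (@lebesgue_measure R \x mu)%E (@tcons n).

Let lebesgue_tupleS0 : lebesgue_tupleS set0 = 0%E.
Proof. by rewrite /lebesgue_tupleS /pushforward preimage_set0 measure0. Qed.

Let lebesgue_tupleS_ge0 A : (0 <= lebesgue_tupleS A)%E.
Proof. by rewrite /lebesgue_tupleS /pushforward; exact: measure_ge0. Qed.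

Let lebesgue_tupleS_sigma_additive : semi_sigma_additive lebesgue_tupleS.
Proof.
move=> F mF tF mUF; rewrite /lebesgue_tupleS /pushforward preimage_bigcup.
have mpre A : measurable A -> measurable (@tcons n @^-1` A).
  by move=> mA; rewrite -[X in measurable X]setTI; exact: measurable_tcons.
apply: measure_semi_sigma_additive.
- by move=> k; exact: mpre.
- apply/trivIsetP => /= i j _ _ ij; rewrite -preimage_setI.
  by move/trivIsetP : tF => /(_ _ _ _ _ ij) ->//; rewrite preimage_set0.
- by rewrite -preimage_bigcup; exact: mpre.
Qed.

HB.instance Definition _ := isMeasure.Build _ _ _ lebesgue_tupleS
  lebesgue_tupleS0 lebesgue_tupleS_ge0 lebesgue_tupleS_sigma_additive.

Let lebesgue_tupleS_sigma_finite : sigma_finite setT lebesgue_tupleS.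
Proof.
have /sigma_finiteP[F [TF ndF Foo]] := sigma_finiteT (@lebesgue_measure R).
have /sigma_finiteP[G [TG ndG Goo]] := sigma_finiteT mu.
exists (fun k => @tuncons n @^-1` (F k `*` G k)).
  apply/seteqP; split=> // t _.
  have [i _ Fi] : (\bigcup_k F k) (tuncons t).1 by rewrite -TF.
  have [j _ Gj] : (\bigcup_k G k) (tuncons t).2 by rewrite -TG.
  exists (maxn i j) => //; split.
  - by move: Fi; exact/subsetPset/ndF/leq_maxl.
  - by move: Gj; exact/subsetPset/ndG/leq_maxr.
move=> k; have [mF Fk] := Foo k; have [mG Gk] := Goo k; split.
  rewrite -[X in measurable X]setTI; apply: measurable_tuncons => //.
  exact: measurableX.
rewrite /lebesgue_tupleS /pushforward -comp_preimage.
rewrite (_ : _ \o _ = id); last by apply/funext => p; exact: tconsK.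
by rewrite preimage_id product_measure1E// lte_mul_pinfty// ge0_fin_numE.
Qed.

HB.instance Definition _ := Measure_isSigmaFinite.Build _ _ _ lebesgue_tupleS
  lebesgue_tupleS_sigma_finite.

End lebesgue_tupleS.

(* Lebesgue measure on R^n, as the n-fold product measure. *)
Fixpoint lebesgue_tuple n : {sigma_finite_measure set (n.-tuple R) -> \bar R} :=
  match n with
  | 0 => dirac [tuple]
  | m.+1 => lebesgue_tupleS (lebesgue_tuple m)
  end.

End lebesgue_tuple.

Section euclidean_space.
Context {R : realType} {d : nat}.
Implicit Types (x xi : 'cV[R]_d) (g : 'cV[R]_d -> R) (f : 'cV[R]_d -> R[i]).

Definition dot xi x : R := \sum_(i < d) xi i ord0 * x i ord0.

(* The library norm `|x| on matrices is the sup norm. *)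
Definition enorm x : R := Num.sqrt (dot x x).

(* The measurable structure lives on tuples, the topology on columns. *)
Definition vec (t : d.-tuple R) : 'cV[R]_d := \col_i tnth t i.

Definition integrable_Rd f : Prop :=
  (lebesgue_tuple d).-integrable setT (fun t => (complex.Re (f (vec t)))%:E) /\
  (lebesgue_tuple d).-integrable setT (fun t => (complex.Im (f (vec t)))%:E).

Definition integral_Rd f : R[i] :=
  (\int[lebesgue_tuple d]_t complex.Re (f (vec t))) +i*
  (\int[lebesgue_tuple d]_t complex.Im (f (vec t))).

Definition cis (t : R) : R[i] := cos t +i* sin t.

Definition fourier f xi : R[i] :=
  integral_Rd (fun x => f x * cis (- (2 * pi * dot xi x))).

(* The empty sequence of directions gives g itself. *)
Definition partials (I : seq 'I_d) g : 'cV[R]_d -> R :=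
  foldr (fun i h => 'D_(delta_mx i ord0) h) g I.

Definition smooth_real g : Prop :=
  forall I : seq 'I_d,
    continuous (partials I g) /\
    forall i x, derivable (partials I g) x (delta_mx i ord0).

Definition schwartz_real g : Prop :=
  smooth_real g /\
  forall (k : nat) (I : seq 'I_d),
    exists C : R, forall x, enorm x ^+ k * `|partials I g x| <= C.

Definition smooth f : Prop :=
  smooth_real (fun x => complex.Re (f x)) /\ smooth_real (fun x => complex.Im (f x)).

Definition schwartz f : Prop :=
  schwartz_real (fun x => complex.Re (f x)) /\ schwartz_real (fun x => complex.Im (f x)).

Definition smooth_compact_support f : Prop :=
  smooth f /\ compact (closure [set x | f x != 0]).

(* u = (-Delta)^s f. A continuous integrable function is determined by its
   Fourier transform, so for each f there is at most one such u; for Schwartz f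
   and s > 0 the function (-Delta)^s f is integrable, so its Fourier transform
   is given by the integral. *)
Definition is_frac_laplacian (s : R) f (u : 'cV[R]_d -> R[i]) : Prop :=
  [/\ smooth u, integrable_Rd u &
      forall xi, fourier u xi = (enorm xi `^ (2 * s))%:C * fourier f xi].

Definition bandlimited_schwartz : set ('cV[R]_d -> R[i]) :=
  [set f | schwartz f /\ smooth_compact_support (fourier f)].

Definition lattice (M : 'M[R]_d) : set 'cV[R]_d :=
  [set M *m map_mx intr k | k in [set: 'cV[int]_d]].

Definition frac_laplacian_nonuniqueness_pair (s : R)
    (H : set ('cV[R]_d -> R[i])) (A B : set 'cV[R]_d) : Prop :=
  exists f u, [/\ H f, f <> (fun=> 0), is_frac_laplacian s f u,
    (forall x, A x -> f x = 0) & (forall x, B x -> u x = 0)].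

End euclidean_space.

(* Main.v *)
(* The vanishing of f on the lattice M Z^d says that the periodization of its
   Fourier transform F over the dual lattice vanishes, and the vanishing of
   (-Delta)^s f says the same of |xi|^(2s) F. Let e be a nonzero dual lattice
   vector and p_j(xi) = |xi + j e|^(2s). For a bump K around e, the functions
   phi_0 = K (p_2 - p_1), phi_1 = K (p_0 - p_2), phi_2 = K (p_1 - p_0) satisfy
   sum phi_j = 0 and sum p_j phi_j = 0, so F(xi) = sum_j phi_j(xi - j e) has both
   properties. It is nonzero at e: K is supported in the ball of radius |e| around
   e, so only the term j = 0 is left there, and p_1, p_2 differ at e.

   The bumps are built from t^a exp(-1/t), a family closed under differentiation
   and under multiplication by powers of t, so that also the singularity of
   |xi + j e|^(2s) is absorbed.

   That f, defined as the inverse transform of F, has Fourier transform F is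
   proved by inserting exp(-eps sum |x_i|), whose transform is a product of
   Poisson kernels, exchanging the integrals, and letting eps tend to 0. *)
From HB Require Import structures.
Require Import Defs.
From mathcomp Require Import all_boot all_order all_algebra.
From mathcomp Require Import all_classical all_reals all_analysis.
From mathcomp Require Import measurable_realfun complex.
From mathcomp Require Import ring lra.

Import Order.TTheory GRing.Theory Num.Theory.
Import numFieldNormedType.Exports.
Local Open Scope classical_set_scope.
Local Open Scope ring_scope.
Set Implicit Arguments.
Unset Strict Implicit.
Unset Printing Implicit Defensive.

(** * Smooth compactly supported functions *)

(** The two conditions are two linear equations, so three translates leave room for a nonzero
    solution: the triple of the phi_j is K times the cross product of (1, 1, 1) and (p_0, p_1, p_2).
    The vanishing on the lattice is then checked directly: where e.x is an integer, translating a
    function by e does not change its inverse transform at x, so at such x the three translates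
    recombine into the inverse transform of sum phi_j = 0. The function (-Delta)^s f is taken to be
    the inverse transform of |xi|^(2s) F. This is again a test function, so a single inversion
    theorem, applied to both spectra, gives the relation between the two transforms. Inversion
    requires integrable inverse transforms. Their real and imaginary parts lie in the class of sums
    of a cosine and a sine transform of test functions. This class is closed under partial
    derivatives and, by integration by parts, under multiplication by coordinates, and its members
    are bounded. Smoothness, the Schwartz bounds and integrability all follow from these three
    facts. *)

Section directional_derivatives.
Context {R : realType} {V : normedModType R}.
Implicit Types (f : V -> R) (x v : V).

Lemma is_derive_line f x v (df : R) :
  is_derive x v f df <-> is_derive (0 : R) 1 (fun t : R => f (t *: v + x)) df.
Proof.
have E : (fun h : R => h^-1 *: ((f \o shift x) (h *: v) - f x)) =
         (fun h : R => h^-1 *: (((fun t : R => f (t *: v + x)) \o shift 0)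
            (h *: (1 : R)) - f (0 *: v + x))).
  by apply/funext => h /=; rewrite addr0 scale0r add0r [_%:A]mulr1.
split=> -[fD <-]; split.
- by move/derivable1P : fD.
- by rewrite /derive E.
- by apply/derivable1P.
- by rewrite /derive E.
Qed.

(** Only a derivative along [v] is given. On the line t -> f (t v + x) derivability is
    differentiability, so the one-variable chain rule applies there. *)
Lemma is_derive_chain (h : R -> R) f x v (df dh : R) :
  is_derive x v f df -> is_derive (f x) 1 h dh ->
  is_derive x v (h \o f) (dh * df).
Proof.
move=> /is_derive_line[fD <-] [hD <-]; apply/is_derive_line.
pose g := fun t : R => f (t *: v + x).
have g0 : g 0 = f x by rewrite /g scale0r add0r.
have hD' : derivable h (g 0) 1 by rewrite g0.
split.
  move/derivable1_diffP : fD => fD; move/derivable1_diffP : hD' => hD'.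
  exact/derivable1_diffP/(@differentiable_comp _ _ _ _ g h 0 fD hD').
have := @derive1_comp R g h 0 fD hD'.
by rewrite !derive1E g0.
Qed.

(** Turns a Taylor estimate into a derivative. It serves affine functions (with [C = 0]), the flat
    point of [flat_powR], and differentiation under the integral sign. *)
Lemma is_derive_quadratic f x v (df C : R) :
  (forall t : R, `|t| <= 1 -> `|f (t *: v + x) - f x - t * df| <= C * t ^+ 2) ->
  is_derive x v f df.
Proof.
move=> H.
have C0 : 0 <= C.
  by have := H 1; rewrite normr1 expr1n mulr1 => /(_ (lexx _)); exact: le_trans.
suff cv : h^-1 *: ((f \o shift x) (h *: v) - f x) @[h --> 0^'] --> df.
  by split; [apply/cvg_ex; exists df|exact/cvg_lim].
apply/cvgrPdist_le => e e0; near=> t.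
have t0 : t != 0 by near: t; exact: nbhs_dnbhs_neq.
have t1 : `|t| <= Num.min 1 (e / (C + 1)).
  near: t; apply: dnbhs0_le; rewrite lt_min ltr01/= divr_gt0//.
  by rewrite ltr_wpDl.
move: t1; rewrite le_min => /andP[t1 te].
rewrite /= -(ler_pM2l (_ : 0 < `|t|)) ?normr_gt0// -normrM.
rewrite -[_ *: _]/(_ * _) mulrBr mulrA divff// mul1r distrC.
apply: (le_trans (H t t1)).
rewrite -(real_normK (num_real t)) expr2 mulrCA ler_wpM2l//.
rewrite (@le_trans _ _ ((C + 1) * `|t|))// ?ler_wpM2r ?lerDl//.
by rewrite mulrC -ler_pdivlMr// ltr_wpDl.
Unshelve. all: by end_near. Qed.

End directional_derivatives.

(** * Powers times exp(-1/t), extended by zero *)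

Section flat_powers.
Context {R : realType}.
Implicit Types (a t : R).

Definition flat_powR a t : R := if 0 < t then t `^ a * expR (- t^-1) else 0.

Lemma flat_powR_gt0 a t : 0 < t -> 0 < flat_powR a t.
Proof. by move=> t0; rewrite /flat_powR t0 mulr_gt0 ?powR_gt0 ?expR_gt0. Qed.

Lemma flat_powR_le0 a t : t <= 0 -> flat_powR a t = 0.
Proof. by rewrite /flat_powR leNgt => /negbTE ->. Qed.

Lemma flat_powRM a t : 0 <= t -> a != 0 -> flat_powR a t = t `^ a * flat_powR 0 t.
Proof.
rewrite le_eqVlt => /predU1P[<- a0|t0 _]; first by rewrite powR0// mul0r flat_powR_le0.
by rewrite /flat_powR t0 powRr0 mul1r.
Qed.

(** From exp(1/t) >= t^-(n+1) / (n+1)! follows exp(-1/t) <= (n+1)! t^(n+1). Choosing n + 1 >= 1 - a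
    makes t^(a+n+1) <= t on ]0, 1]. *)
Lemma flat_powR_linear a : exists C : R, 0 <= C /\
  forall t, t <= 1 -> `|flat_powR a t| <= C * `|t|.
Proof.
have [n an] : exists n : nat, 1 - a <= n.+1%:R.
  exists (Num.truncn `|1 - a|).
  apply: le_trans (ler_norm _) _.
  by rewrite ltW// truncnS_gt.
exists n.+1`!%:R; split=> // t t1; rewrite /flat_powR.
case: ltP => [t0|_]; last by rewrite normr0 mulr_ge0.
rewrite ger0_norm ?mulr_ge0 ?powR_ge0 ?expR_ge0// (gtr0_norm t0).
have le1 : expR (- t^-1) <= n.+1`!%:R * t ^+ n.+1.
  rewrite expRN -ler_pV2; last 2 first.
    have p : (0 : R) < n.+1`!%:R * t ^+ n.+1.
      by rewrite mulr_gt0 ?exprn_gt0// ltr0n fact_gt0.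
    by rewrite inE unitfE (gt_eqF p) p.
    have p : 0 < (expR t^-1)^-1 by rewrite invr_gt0 expR_gt0.
    by rewrite inE unitfE (gt_eqF p) p.
  rewrite invrK invfM mulrC -exprVn.
  apply: le_trans (expR_ge1Dxn n _); first by rewrite lerDr.
  by rewrite invr_ge0 ltW.
apply: le_trans (ler_wpM2l (powR_ge0 _ _) le1) _.
rewrite mulrCA ler_wpM2l// -powR_mulrn ?(ltW t0)// -powRD; last first.
  by rewrite (gt_eqF t0) implybT.
rewrite -[leRHS]powRr1 ?(ltW t0)// ger_powR ?t0//.
by rewrite -lerBlDl.
Qed.

Lemma is_derive_flat_powR a t :
  is_derive t 1 (flat_powR a) (a * flat_powR (a - 1) t + flat_powR (a - 2) t).
Proof.
have [t0|t0|->] := ltgtP t 0.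
- rewrite !flat_powR_le0 ?(ltW t0)// mulr0 addr0.
  apply: (@near_eq_is_derive _ _ _ (cst 0)).
  near=> u; rewrite flat_powR_le0//; apply: ltW; near: u; exact: lt_nbhsl.
- apply: (@near_eq_is_derive _ _ _ (fun u => u `^ a * expR (- u^-1))).
    by near=> u; rewrite /flat_powR ifT//; near: u; exact: lt_nbhsr.
  have tn0 : t != 0 by rewrite gt_eqF.
  have d1 := is_derive1_powR a t0.
  have d2 : is_derive t 1 (fun u : R => - u^-1) (t ^- 2).
    have dV : is_derive t 1 (fun u : R => u^-1) (- t ^- 2).
      split; first exact: derivableV.
      by rewrite deriveV// derive_id [_ *: _]mulr1.
    have := is_deriveN dV; rewrite opprK; exact.
  have d3 := @is_derive_chain _ _ expR _ _ _ _ _ d2 (is_derive_expR _).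
  have := is_deriveM d1 d3.
  have -> : flat_powR (a - 2) t = t `^ a * (t ^- 2) * expR (- t^-1).
    by rewrite /flat_powR t0 powRD ?tn0 ?implybT// powR_invn ?(ltW t0).
  rewrite /= /flat_powR t0 => d; apply: is_derive_eq.
  by rewrite /GRing.scale/=; ring.
(* At 0: for u > 0 the function is u times [flat_powR (a - 1) u], hence O(u^2) by the linear bound
   for the exponent a - 1, so its derivative vanishes. *)
- rewrite !flat_powR_le0// mulr0 addr0.
  have [C [C0 HC]] := flat_powR_linear (a - 1).
  apply: (@is_derive_quadratic _ _ _ _ _ _ C) => u u1.
  rewrite mulr0 subr0 addr0 [_ *: _]mulr1 (flat_powR_le0 _ (lexx 0)) subr0.
  have [u0|u0] := leP u 0; first by rewrite flat_powR_le0// normr0 mulr_ge0// sqr_ge0.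
  have -> : flat_powR a u = u * flat_powR (a - 1) u.
    rewrite /flat_powR u0 mulrA; congr (_ * _).
    rewrite -{2}(powRr1 (ltW u0)) -powRD ?addrNK// ?(gt_eqF u0) ?implybT//.
    by rewrite addrC subrK.
  rewrite normrM -(real_normK (num_real u)) expr2 mulrCA ler_wpM2l//.
  by apply: HC; rewrite (le_trans (ler_norm _)).
Unshelve. all: by end_near. Qed.

End flat_powers.

Section elementary_functions.
Context {R : realType} {d : nat}.
Implicit Types (f g : 'cV[R]_d -> R) (x c : 'cV[R]_d) (i : 'I_d).

(* A syntactic class closed under partial derivatives: smoothness of its members
   follows by induction, without a theory of iterated derivatives. *)
Inductive elementary : ('cV[R]_d -> R) -> Prop :=
| elementary_cst (a : R) : elementary (fun=> a)
| elementary_coord i : elementary (fun x => x i ord0)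
| elementaryD f g : elementary f -> elementary g -> elementary (fun x => f x + g x)
| elementaryM f g : elementary f -> elementary g -> elementary (fun x => f x * g x)
| elementary_flat a f : elementary f -> elementary (fun x => flat_powR a (f x))
| elementary_cos f : elementary f -> elementary (fun x => cos (f x))
| elementary_sin f : elementary f -> elementary (fun x => sin (f x)).

Lemma elementaryN f : elementary f -> elementary (fun x => - f x).
Proof.
move=> ef; rewrite (_ : (fun x => _) = fun x => -1 * f x).
  exact/elementaryM/ef/elementary_cst.
by apply/funext => x; rewrite mulN1r.
Qed.

Lemma elementaryB f g : elementary f -> elementary g -> elementary (fun x => f x - g x).
Proof. by move=> ef eg; exact/elementaryD/elementaryN. Qed.

Lemma elementary_sum I (r : seq I) (F : I -> 'cV[R]_d -> R) :
  (forall j, elementary (F j)) -> elementary (fun x => \sum_(j <- r) F j x).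
Proof.
move=> eF; elim: r => [|j r ih].
  by under eq_fun do rewrite big_nil; exact: elementary_cst.
by under eq_fun do rewrite big_cons; exact: elementaryD.
Qed.

Lemma elementary_comp_coord (h : 'cV[R]_d -> 'cV[R]_d) f :
  (forall i, elementary (fun x => h x i ord0)) -> elementary f ->
  elementary (fun x => f (h x)).
Proof.
move=> eh; elim=> *; try by constructor.
exact: eh.
Qed.

Lemma elementary_shift c f : elementary f -> elementary (fun x => f (x + c)).
Proof.
apply: elementary_comp_coord => i; under eq_fun do rewrite mxE.
by apply: elementaryD; constructor.
Qed.

Lemma elementary_dot c : elementary (fun x => dot x c).
Proof.
by apply: elementary_sum => i; apply: elementaryM; constructor.
Qed.

Lemma elementary_sqnorm : elementary (fun x => dot x x).
Proof.
by apply: elementary_sum => i; apply: elementaryM; constructor.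
Qed.

Lemma is_derive_coord x i j :
  is_derive x (delta_mx i ord0) (fun y : 'cV[R]_d => y j ord0) (j == i)%:R.
Proof.
apply: (@is_derive_quadratic _ _ _ _ _ _ 0) => t _.
by rewrite !mxE eqxx andbT addrK subrr normr0 mul0r.
Qed.

Lemma elementary_derive f i : elementary f ->
  exists2 g, elementary g & forall x, is_derive x (delta_mx i ord0) f (g x).
Proof.
elim=> {f} [a|j|f g ef [df edf Hf] eg [dg edg Hg]|f g ef [df edf Hf] eg [dg edg Hg]
  |a f ef [df edf Hf]|f ef [df edf Hf]|f ef [df edf Hf]].
- by exists (fun=> 0); [exact: elementary_cst|move=> x; exact: is_derive_cst].
- exists (fun=> (j == i)%:R); first exact: elementary_cst.
  by move=> x; exact: is_derive_coord.
- exists (fun x => df x + dg x); first exact: elementaryD.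
  by move=> x; exact: is_deriveD.
- exists (fun x => f x * dg x + g x * df x).
    by apply: elementaryD; exact: elementaryM.
  by move=> x; exact: is_deriveM.
- exists (fun x => (a * flat_powR (a - 1) (f x) + flat_powR (a - 2) (f x)) * df x).
    apply: elementaryM => //; apply: elementaryD; last exact: elementary_flat.
    by apply: elementaryM; [exact: elementary_cst|exact: elementary_flat].
  move=> x; exact: (is_derive_chain (Hf x) (is_derive_flat_powR _ _)).
- exists (fun x => - sin (f x) * df x).
    by apply: elementaryM => //; apply: elementaryN; exact: elementary_sin.
  move=> x; exact: (is_derive_chain (Hf x) (is_derive_cos _)).
- exists (fun x => cos (f x) * df x).
    by apply: elementaryM => //; exact: elementary_cos.
  move=> x; exact: (is_derive_chain (Hf x) (is_derive_sin _)).
Qed.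

Lemma continuous_flat_powR a : continuous (@flat_powR R a).
Proof.
move=> t; apply/differentiable_continuous/derivable1_diffP.
by have [] := is_derive_flat_powR a t.
Qed.

Lemma elementary_continuous f : elementary f -> continuous f.
Proof.
elim=> {f} [a|j|f g _ cf _ cg|f g _ cf _ cg|a f _ cf|f _ cf|f _ cf] x.
- exact: cst_continuous.
- exact: (@coord_continuous R d 1 j ord0 x).
- exact: (cvgD (cf x) (cg x)).
- exact: (cvgM (cf x) (cg x)).
- by exact: (continuous_comp (cf x) (@continuous_flat_powR _ _)).
- by exact: (continuous_comp (cf x) (@continuous_cos _ _)).
- by exact: (continuous_comp (cf x) (@continuous_sin _ _)).
Qed.

Lemma elementary_partials f (I : seq 'I_d) : elementary f -> elementary (partials I f).
Proof.
move=> ef; elim: I => [//|i I ih] /=.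
have [g eg Hg] := elementary_derive i ih.
rewrite (_ : (fun x => _) = g)//.
by apply/funext => x; exact: (@derive_val _ _ _ _ _ _ _ (Hg x)).
Qed.

Lemma elementary_smooth f : elementary f -> smooth_real f.
Proof.
move=> ef I; have eI := elementary_partials I ef; split.
  exact: elementary_continuous.
by move=> i x; have [g _ /(_ x)[]] := elementary_derive i eI.
Qed.

Lemma flat_powR_bounded a (M : R) : exists C : R, forall t, `|t| <= M -> `|flat_powR a t| <= C.
Proof.
have [M0|M0] := leP 0 M; last first.
  by exists 0 => t tM; have := le_lt_trans (le_trans (normr_ge0 t) tM) M0; rewrite ltxx.
have [c _ Hc] : exists2 c, c \in `[- M, M] &
    forall t, t \in `[- M, M] -> flat_powR a t <= flat_powR a c.
  apply: EVT_max; first by rewrite ge0_cp.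
  by apply: continuous_subspaceT; exact: continuous_flat_powR.
exists (flat_powR a c) => t tM; rewrite ger0_norm.
  by apply: Hc; rewrite in_itv/= -ler_norml.
have [t0|t0] := leP t 0; first by rewrite flat_powR_le0.
by rewrite ltW// flat_powR_gt0.
Qed.

(** Bounds on boxes propagate through the constructors. The extreme value theorem enters only in one
    variable, for [flat_powR] on an interval. *)
Lemma elementary_bounded f (B : R) : elementary f ->
  exists M : R, forall x, (forall i, `|x i ord0| <= B) -> `|f x| <= M.
Proof.
elim=> {f} [a|j|f g _ [M HM] _ [N HN]|f g _ [M HM] _ [N HN]|a f _ [M HM]|f _ _|f _ _].
- by exists `|a|.
- by exists B => x; exact.
- exists (M + N) => x xB; rewrite (le_trans (ler_normD _ _))// lerD//; [exact: HM|exact: HN].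
- exists (M * N) => x xB; rewrite normrM ler_pM//; [exact: HM|exact: HN].
- have [C HC] := flat_powR_bounded a M.
  by exists C => x /HM/HC.
- by exists 1 => x _; rewrite ler_norml cos_geN1 cos_le1.
- by exists 1 => x _; rewrite ler_norml sin_geN1 sin_le1.
Qed.

Definition box_supported f :=
  exists B : R, forall x i, B < `|x i ord0| -> f x = 0.

Definition test_function f := elementary f /\ box_supported f.

Lemma test_functionD f g :
  test_function f -> test_function g -> test_function (fun x => f x + g x).
Proof.
move=> [ef [A fA]] [eg [B gB]]; split; first exact: elementaryD.
exists (Num.max A B) => x i; rewrite gt_max => /andP[xA xB].
by rewrite (fA _ _ xA) (gB _ _ xB) addr0.
Qed.

Lemma test_functionM f g :
  elementary f -> test_function g -> test_function (fun x => f x * g x).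
Proof.
move=> ef [eg [B gB]]; split; first exact: elementaryM.
by exists B => x i xB; rewrite (gB _ _ xB) mulr0.
Qed.

Lemma test_function_shift c f : test_function f -> test_function (fun x => f (x + c)).
Proof.
move=> [ef [B fB]]; split; first exact: elementary_shift.
exists (B + `|c|) => x i xB; apply: (fB _ i).
rewrite mxE; rewrite -ltrBrDr in xB; apply: lt_le_trans xB _.
rewrite lerBlDr (@le_trans _ _ (`|x i ord0 + c i ord0| + `|c i ord0|))//.
  by rewrite -[in leLHS](addrK (c i ord0) (x i ord0)) ler_normB.
rewrite lerD2l [leRHS]/Num.norm/= mx_normrE.
exact: (le_bigmax _ (fun ij => `|c ij.1 ij.2|) (i, ord0)).
Qed.

(** The set where some |x_j| > B is open, so [f] vanishes near each of its points and the derivative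
    keeps the same box. *)
Lemma test_function_derive f i : test_function f ->
  exists2 g, test_function g & forall x, is_derive x (delta_mx i ord0) f (g x).
Proof.
move=> [ef [B fB]]; have [g eg Hg] := elementary_derive i ef.
exists g => //; split=> //; exists B => x j xB.
have [_ <-] := Hg x.
rewrite (_ : 0 = 'D_(delta_mx i ord0) (cst 0 : 'cV[R]_d -> R) x); last first.
  by rewrite derive_cst.
apply: near_eq_derive; near=> y; rewrite (fB y j)//; near: y.
have cj : `|y j ord0| @[y --> x] --> `|x j ord0|.
  apply: cvg_norm; exact: (@coord_continuous R d 1 j ord0 x).
exact: (cvgr_gt _ cj).
Unshelve. all: by end_near. Qed.

Lemma test_function_bounded f : test_function f -> exists M : R, forall x, `|f x| <= M.
Proof.
move=> [ef [B fB]]; have [M HM] := elementary_bounded B ef.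
exists (Num.max M 0) => x; rewrite le_max.
have [xB|] := pselect (forall i, `|x i ord0| <= B); first by rewrite HM.
move=> /existsNP[i /negP]; rewrite -ltNge => /fB ->.
by rewrite normr0 lexx orbT.
Qed.

End elementary_functions.

(** * Integration on tuples *)

Section tuple_integration.
Context {R : realType}.
Local Open Scope ereal_scope.
Notation lam := (@lebesgue_measure R).
Notation lamn n := (@lebesgue_tuple R n).

Lemma ge0_integral_lebesgue_tupleS n (g : n.+1.-tuple R -> \bar R) :
  measurable_fun setT g -> (forall t, 0 <= g t) ->
  \int[lamn n.+1]_t g t = \int[lam]_x \int[lamn n]_t g (tcons (x, t)).
Proof.
move=> mg g0.
transitivity (\int[lam \x lamn n]_p g (tcons p)).
  have := @ge0_integral_pushforward _ _ _ _ _ _ (@measurable_tcons R n)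
    (lam \x lamn n)%E setT g measurableT mg (fun t _ => g0 t).
  by rewrite preimage_setT.
rewrite (fubini_tonelli1 (g \o @tcons R n))//.
  exact: (measurableT_comp mg (@measurable_tcons R n)).
by move=> p /=.
Qed.

Lemma integral_lebesgue_tupleS n (g : n.+1.-tuple R -> \bar R) :
  (lamn n.+1).-integrable setT g ->
  \int[lamn n.+1]_t g t = \int[lam]_x \int[lamn n]_t g (tcons (x, t)).
Proof.
move=> ig.
have mg : measurable_fun setT g by case/integrableP : ig.
have mgt : measurable_fun setT (g \o @tcons R n).
  exact: (measurableT_comp mg (@measurable_tcons R n)).
have igt : (lam \x lamn n).-integrable setT (g \o @tcons R n).
  apply/integrableP; split => //.
  case/integrableP : ig => _; rewrite ge0_integral_lebesgue_tupleS//; last first.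
    exact: measurableT_comp.
  rewrite -(fubini_tonelli1 (abse \o (g \o @tcons R n)))//.
  - exact: measurableT_comp.
  - by move=> p /=.
transitivity (\int[lam \x lamn n]_p g (tcons p)).
  have := @integral_pushforward _ _ _ _ _ _ (@measurable_tcons R n)
    (lam \x lamn n)%E setT g _ igt measurableT.
  by rewrite preimage_setT; exact.
by rewrite -(integral12_prod_meas1 igt).
Qed.

(** Used in two cases: [c = 0] rescales the Poisson kernel, and [a = 1] gives translation
    invariance. *)
Definition affine_tuple n (a : R) (c : 'I_n -> R) (t : n.-tuple R) : n.-tuple R :=
  [tuple (a * tnth t i + c i)%R | i < n].

Lemma measurable_affine_tuple n a c : measurable_fun setT (@affine_tuple n a c).
Proof.
apply/measurable_fun_tnthP => i.
rewrite (_ : _ \o _ = fun t => (a * tnth t i + c i)%R); last first.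
  by apply/funext => t /=; rewrite tnth_mktuple.
by apply: measurable_funD => //; apply: measurable_funM => //; exact: measurable_tnth.
Qed.

(** The measure [a] times the image of Lebesgue measure under x -> a x + b agrees with Lebesgue
    measure on half-open intervals, hence on all measurable sets. *)
Lemma ge0_integral_affine (a b : R) (g : R -> \bar R) : (0 < a)%R ->
  measurable_fun setT g -> (forall x, 0 <= g x) ->
  \int[lam]_x g x = a%:E * \int[lam]_x g (a * x + b)%R.
Proof.
move=> a0 mg g0.
pose phi : measurableTypeR R -> measurableTypeR R := fun x => (a * x + b)%R.
have mphi : measurable_fun setT phi.
  by apply: measurable_funD => //; exact: measurable_funM.
pose k : {nonneg R} := NngNum (ltW a0).
pose nu' : {measure set (measurableTypeR R) -> \bar R} := mscale k (pushforward lam phi).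
pose nu := nu' mphi.
have nuE A : measurable A -> lam A = nu A.
  move=> mA; apply: lebesgue_measure_unique => // _ [[p q]] _ <-.
  rewrite /nu /nu' /= /mscale/= /pushforward.
  rewrite (_ : phi @^-1` _ = `]((p - b) / a)%R, ((q - b) / a)%R]%classic); last first.
    apply/seteqP; split => x /=; rewrite !in_itv/= /phi.
      by rewrite ltr_pdivrMr// ler_pdivlMr// ltrBlDr lerBrDr mulrC.
    by rewrite ltr_pdivrMr// ler_pdivlMr// ltrBlDr lerBrDr mulrC.
  rewrite !lebesgue_measure_itv/= !lte_fin ltr_pM2r ?invr_gt0// ltrD2r.
  case: ifPn => _; last by rewrite mule0.
  by rewrite /= -!EFinD -?EFinN -?EFinD -?EFinM; congr EFin; field; rewrite gt_eqF.
transitivity (\int[nu]_x g x); first by apply: eq_measure_integral => A mA _; exact: nuE.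
rewrite ge0_integral_mscale//; congr (_ * _).
have := @ge0_integral_pushforward _ _ _ _ _ phi mphi lam setT g measurableT mg (fun t _ => g0 t).
by rewrite preimage_setT.
Qed.

Lemma ge0_integral_affine_tuple n (a : R) (c : 'I_n -> R) (g : n.-tuple R -> \bar R) :
  (0 < a)%R -> measurable_fun setT g -> (forall t, 0 <= g t) ->
  \int[lamn n]_t g t = (a ^+ n)%:E * \int[lamn n]_t g (affine_tuple a c t).
Proof.
move=> a0; elim: n c g => [|n ih] c g mg g0.
  rewrite expr0 mul1e; apply: eq_integral => t _; congr g.
  by apply: eq_from_tnth => -[].
have mgt : measurable_fun setT (g \o @tcons R n).
  exact: (measurableT_comp mg (@measurable_tcons R n)).
rewrite ge0_integral_lebesgue_tupleS//.
pose c' i := c (lift ord0 i).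
have maff : measurable_fun setT (g \o affine_tuple a c).
  exact: (measurableT_comp mg (measurable_affine_tuple a c)).
rewrite [in RHS](@ge0_integral_lebesgue_tupleS _ (g \o affine_tuple a c))//; last first.
  by move=> t; exact: g0.
have E x t : affine_tuple a c (tcons (x, t)) = tcons ((a * x + c ord0)%R, affine_tuple a c' t).
  apply: eq_from_tnth => i; rewrite tnth_mktuple.
  case: (unliftP ord0 i) => [j|] ->; last by rewrite !tnth0.
  by rewrite !tnthS tnth_mktuple.
under [in RHS]eq_integral => x _ do under eq_integral => t _ do rewrite /= E.
pose G x := \int[lamn n]_t g (tcons (x, t)).
have mG : measurable_fun setT G.
  by apply: (measurable_fun_fubini_tonelli_F (g \o @tcons R n) mgt) => p; exact: g0.
have G0 x : 0 <= G x by exact: integral_ge0.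
etransitivity; first exact: (ge0_integral_affine (c ord0) a0 mG G0).
rewrite exprSr EFinM [(a ^+ n)%:E * _]muleC -muleA; congr (_ * _).
rewrite -ge0_integralZl//; last 3 first.
- apply: (measurable_fun_fubini_tonelli_F (fun p => g (tcons ((a * p.1 + c ord0)%R, affine_tuple a c' p.2)))) => //.
  rewrite (_ : (fun p => _) = g \o affine_tuple a c \o @tcons R n).
    exact: (measurableT_comp maff (@measurable_tcons R n)).
  by apply/funext => -[x t] /=; rewrite E.
- by move=> x _; exact: integral_ge0.
- by rewrite lee_fin exprn_ge0// ltW.
apply: eq_integral => x _.
apply: (ih c' (fun t => g (tcons ((a * x + c ord0)%R, t)))) => //.
by apply: (measurableT_comp mgt); exact: measurable_fun_pair.
Qed.

Lemma integrable_affine_tuple n (a : R) (c : 'I_n -> R) (g : n.-tuple R -> \bar R) :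
  (0 < a)%R -> (lamn n).-integrable setT g ->
  (lamn n).-integrable setT (g \o affine_tuple a c).
Proof.
move=> a0 /integrableP[mg ig]; apply/integrableP; split.
  exact: (measurableT_comp mg (measurable_affine_tuple a c)).
move: ig; rewrite (@ge0_integral_affine_tuple _ a c)//; last exact: measurableT_comp.
have an0 : (0 < a ^+ n)%R by rewrite exprn_gt0.
by rewrite -[X in _ < X -> _](gt0_muley (_ : 0 < (a ^+ n)%:E))// lte_pmul2l.
Qed.

Lemma Rintegral_affine_tuple n (a : R) (c : 'I_n -> R) (g : n.-tuple R -> R) :
  (0 < a)%R -> (lamn n).-integrable setT (EFin \o g) ->
  (\int[lamn n]_t g t = a ^+ n * \int[lamn n]_t g (affine_tuple a c t))%R.
Proof.
move=> a0 ig; have ig' := integrable_affine_tuple c a0 ig.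
have mg := measurable_int _ ig.
rewrite -RintegralZl// /Rintegral; congr fine.
under [RHS]eq_integral do rewrite EFinM.
rewrite integralZl//.
rewrite [LHS](integralE _ _ (EFin \o g)).
rewrite [in RHS](integralE _ _ (EFin \o g \o affine_tuple a c)).
rewrite [in RHS]muleBr; [|by []|].
  congr (_ - _).
    rewrite (ge0_integral_affine_tuple c a0 (measurable_funepos mg) (funepos_ge0 _)).
    by congr (_ * _); apply: eq_integral => t _; rewrite !funeposE.
  rewrite (ge0_integral_affine_tuple c a0 (measurable_funeneg mg) (funeneg_ge0 _)).
  by congr (_ * _); apply: eq_integral => t _; rewrite !funenegE.
apply: fin_num_adde_defr.
by have := integrable_pos_fin_num measurableT ig'; exact.
Qed.

End tuple_integration.

Section measurability.
Context {R : realType} {d : nat}.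

(** Bridges the product sigma-algebra on tuples and the topology on columns. Rounding each
    coordinate down to a multiple of 1/(m+1) leaves countably many values, whose fibres are finite
    intersections of preimages of half-open intervals. By continuity, [F] of the rounded points
    converges to [F] pointwise. *)
Lemma measurable_continuous_vec (F : 'cV[R]_d -> R) :
  continuous F -> measurable_fun [set: d.-tuple R] (F \o vec).
Proof.
move=> cF.
pose disc (m : nat) (k : 'cV[int]_d) : 'cV[R]_d := \col_i ((k i ord0)%:~R / m.+1%:R).
pose fl (m : nat) (t : d.-tuple R) : 'cV[int]_d := \col_i Num.floor (tnth t i * m.+1%:R).
apply: (@measurable_fun_cvg _ _ _ _ (fun m => F \o disc m \o fl m)).
  move=> m _ Y mY; rewrite setTI.
  rewrite (_ : _ @^-1` Y = \bigcup_(k in [set k | Y (F (disc m k))]) [set t | fl m t = k]); last first.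
    apply/seteqP; split => [t /= Yt|t [k /= Yk kE]]; last by rewrite /= kE.
    by exists (fl m t).
  rewrite bigcup_mkcond.
  apply: countable_bigcupT_measurable => [|k]; first exact: countableP.
  case: ifPn => // _.
  rewrite (_ : [set t | fl m t = k] = \bigcap_(i in [set: 'I_d])
      ((fun t : d.-tuple R => tnth t i * m.+1%:R) @^-1`
        `[(k i ord0)%:~R, ((k i ord0) + 1)%:~R[%classic)); last first.
    apply/seteqP; split => [t /= <- i _|t H].
      by rewrite /= in_itv/= mxE floor_itv.
    apply/colP => i; rewrite mxE; apply: floor_def.
    by have := H i I; rewrite /= in_itv/=.
  apply: fin_bigcap_measurable; first exact: finite_finset.
  move=> i _; rewrite -[X in measurable X]setTI.
  have : measurable_fun [set: d.-tuple R] (fun t : d.-tuple R => tnth t i * m.+1%:R).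
    by apply: measurable_funM => //; exact: measurable_tnth.
  by apply => //; exact: measurable_itv.
move=> t _ /=.
suff cv : disc m (fl m t) @[m --> \oo] --> vec t.
  exact: (cvg_comp _ _ cv (cF (vec t))).
apply/cvg_ballP => e e0; near=> m; split => // i j.
rewrite ord1 !mxE /ball/=.
have m0 : (0 : R) < m.+1%:R by rewrite ltr0n.
rewrite -[X in X - _](mulfK (lt0r_neq0 m0)) -mulrBl.
have /andP[f1 f2] := floor_itv (tnth t i * m.+1%:R).
rewrite normrM ger0_norm ?subr_ge0// ger0_norm ?invr_ge0//.
apply: le_lt_trans (_ : 1 * m.+1%:R^-1 < e).
  rewrite ler_wpM2r// lerBlDr addrC; move: f2; rewrite intrD => /ltW; exact.
rewrite mul1r; near: m; exact: (near_infty_natSinv_lt (PosNum e0)).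
Unshelve. all: by end_near. Qed.

End measurability.

(** * Products of one-variable functions and an integrable majorant *)

Section product_functions.
Context {R : realType}.
Notation lam := (@lebesgue_measure R).
Notation lamn n := (@lebesgue_tuple R n).

Definition prod_fun n (h : R -> R) (t : n.-tuple R) : R := \prod_(i < n) h (tnth t i).

Lemma prod_fun_tcons n (h : R -> R) (x : R) (t : n.-tuple R) :
  prod_fun h (tcons (x, t)) = h x * prod_fun h t.
Proof.
rewrite /prod_fun big_ord_recl tnth0; congr (_ * _).
by apply: eq_bigr => i _; rewrite tnthS.
Qed.

Lemma prod_fun_ge0 n (h : R -> R) (t : n.-tuple R) :
  (forall x, 0 <= h x) -> 0 <= prod_fun h t.
Proof. by move=> h0; exact: prodr_ge0. Qed.

Lemma measurable_prod_fun n (h : R -> R) :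
  measurable_fun setT h -> measurable_fun [set: n.-tuple R] (prod_fun h).
Proof.
move=> mh; apply: measurable_prod => i _.
by apply: (measurableT_comp mh); exact: measurable_tnth.
Qed.

Lemma integral_prod_fun n (h : R -> R) (c : R) :
  measurable_fun setT h -> (forall x, 0 <= h x) ->
  (\int[lam]_x (h x)%:E = c%:E)%E ->
  (\int[lamn n]_t (prod_fun h t)%:E = (c ^+ n)%:E)%E.
Proof.
move=> mh h0 hc; elim: n => [|n ih].
  rewrite [LHS](_ : _ = \int[dirac [tuple]]_(t in [set: 0.-tuple R]) (cst 1%:E t))%E; last first.
    by apply: eq_integral => t _; rewrite /prod_fun big_ord0.
  by rewrite integral_dirac// diracT mul1e.
rewrite ge0_integral_lebesgue_tupleS//; last 2 first.
- by apply/measurable_EFinP; exact: measurable_prod_fun.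
- by move=> t; rewrite lee_fin prod_fun_ge0.
under eq_integral => x _.
  under eq_integral do rewrite prod_fun_tcons EFinM.
  rewrite ge0_integralZl//; last 3 first.
  - by apply/measurable_EFinP; exact: measurable_prod_fun.
  - by move=> t _; rewrite lee_fin prod_fun_ge0.
  - by rewrite lee_fin.
  rewrite ih; over.
rewrite ge0_integralZr//; last 3 first.
- exact/measurable_EFinP.
- by move=> x _; rewrite lee_fin.
- rewrite lee_fin exprn_ge0// -lee_fin -hc.
  by apply: integral_ge0 => x _; rewrite lee_fin.
by rewrite hc -EFinM exprS.
Qed.

Lemma integrable_prod_fun n (h : R -> R) (c : R) :
  measurable_fun setT h -> (forall x, 0 <= h x) ->
  (\int[lam]_x (h x)%:E = c%:E)%E ->
  (lamn n).-integrable setT (EFin \o prod_fun h).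
Proof.
move=> mh h0 hc; apply/integrableP; split.
  by apply/measurable_EFinP; exact: measurable_prod_fun.
under eq_integral do rewrite /= ger0_norm ?prod_fun_ge0//.
by rewrite (integral_prod_fun _ mh h0 hc) ltry.
Qed.

Lemma integral_oneDsqrV : (\int[lam]_x ((oneDsqr x)^-1)%:E = pi%:E)%E.
Proof.
rewrite ge0_symfun_integralT//.
- by rewrite -set_itvcy integral0y_oneDsqr -EFinM mulrCA divff// mulr1.
- exact: continuous_oneDsqrV.
- by move=> x; rewrite /= /oneDsqr sqrrN.
Qed.

Lemma measurable_oneDsqrV : measurable_fun setT (fun x : R => (oneDsqr x)^-1).
Proof. by apply: continuous_measurable_fun; exact: continuous_oneDsqrV. Qed.

(** The product of the 1/(1 + x_i^2), of total mass pi^n, is the common majorant for test functions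
    and for their transforms. Being a product, it is integrated one coordinate at a time. *)
Lemma integrable_weighted n (C : R) (g : n.-tuple R -> R) :
  measurable_fun setT g ->
  (forall t, `|g t| <= C * prod_fun (fun x => (oneDsqr x)^-1) t) ->
  (lamn n).-integrable setT (EFin \o g).
Proof.
move=> mg gC.
apply: (@le_integrable _ _ _ (lamn n) setT measurableT _
  (fun t => C%:E * (prod_fun (fun x => (oneDsqr x)^-1) t)%:E))%E.
- exact/measurable_EFinP.
- move=> t _; rewrite /= lee_fin; apply: le_trans (gC t) _.
  exact: ler_norm.
- apply: integrableZl => //.
  apply: (integrable_prod_fun _ measurable_oneDsqrV _ integral_oneDsqrV) => x.
  by rewrite invr_ge0.
Qed.

End product_functions.

Section test_functions.
Context {R : realType} {d : nat}.
Notation lamn n := (@lebesgue_tuple R n).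
Implicit Types F : 'cV[R]_d -> R.

(** On the box each factor satisfies (1 + B^2) / (1 + x_i^2) >= 1, and outside it [F] vanishes. *)
Lemma bounded_box_weight (M B : R) F : (forall x, `|F x| <= M) ->
  (forall (x : 'cV[R]_d) i, B < `|x i ord0| -> F x = 0) ->
  forall t, `|F (vec t)| <=
    M * (1 + B ^+ 2) ^+ d * prod_fun (fun x => (oneDsqr x)^-1) t.
Proof.
move=> FM FB t.
have M0 : 0 <= M by apply: le_trans (FM 0).
have w0 : 0 <= prod_fun (fun x : R => (oneDsqr x)^-1) t.
  by apply: prod_fun_ge0 => x; rewrite invr_ge0.
have [tB|] := pselect (forall i, `|tnth t i| <= B); last first.
  move=> /existsNP[i /negP]; rewrite -ltNge => Bt.
  rewrite (FB _ i) ?mxE// normr0 mulr_ge0// mulr_ge0// exprn_ge0//.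
  by rewrite addr_ge0// sqr_ge0.
apply: le_trans (FM _) _; rewrite -mulrA ler_peMr//.
rewrite (_ : (1 + B ^+ 2) ^+ d = \prod_(i < d) (1 + B ^+ 2)); last first.
  by rewrite prodr_const card_ord.
rewrite -big_split/=; elim/big_ind: _ => [//|x y x1 y1|i _].
  by rewrite -[leLHS]mulr1 ler_pM.
rewrite ler_pdivlMr; last by rewrite ltr_pwDl// sqr_ge0.
rewrite mul1r lerD2l -real_normK ?num_real// lerXn2r// ?nnegrE//.
by apply: le_trans (tB i).
Qed.

Lemma test_function_weight F : test_function F ->
  exists C : R, forall t, `|F (vec t)| <= C * prod_fun (fun x => (oneDsqr x)^-1) t.
Proof.
move=> tF; have [M FM] := test_function_bounded tF.
have [_ [B FB]] := tF.
by exists (M * (1 + B ^+ 2) ^+ d); exact: bounded_box_weight.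
Qed.

Lemma integrable_test F (k : d.-tuple R -> R) : test_function F ->
  measurable_fun setT k -> (forall t, `|k t| <= 1) ->
  (lamn d).-integrable setT (fun t => (F (vec t) * k t)%:E).
Proof.
move=> tF mk k1; have [C FC] := test_function_weight tF.
apply: (@integrable_weighted _ _ C).
  apply: measurable_funM => //; apply: measurable_continuous_vec.
  by apply: elementary_continuous; case: tF.
move=> t; rewrite normrM (le_trans _ (FC t))// ler_piMr//.
Qed.

End test_functions.

(** * Fourier inversion *)

Section poisson_kernel.
Context {R : realType} (eps : R) (eps_gt0 : 0 < eps).
Notation lam := (@lebesgue_measure R).
Implicit Types w x : R.

Definition exp_decay x : R := expR (- (eps * `|x|)).

Lemma exp_decay_ge0 x : 0 <= exp_decay x. Proof. exact: expR_ge0. Qed.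

Lemma continuous_exp_decay : continuous exp_decay.
Proof.
move=> x; apply: continuous_comp; last exact: continuous_expR.
by apply: cvgN; apply: cvgM; [exact: cvg_cst|exact: norm_continuous].
Qed.

Lemma measurable_exp_decay : measurable_fun setT exp_decay.
Proof. by apply: continuous_measurable_fun; exact: continuous_exp_decay. Qed.

(** The constant 1 contributes -1/eps, and the fraction comes from the real part of exp((-eps + i w)
    x) / (-eps + i w). It is an antiderivative of [exp_decay] times 1 + cos on x >= 0. *)
Let primitive w x : R :=
  expR (- (eps * x)) * (- eps^-1 + (w * sin (w * x) - eps * cos (w * x)) / (eps ^+ 2 + w ^+ 2)).

Let is_derive_primitive w x :
  is_derive x 1 (primitive w) (expR (- (eps * x)) * (1 + cos (w * x))).
Proof.
have lin a : is_derive x 1 (fun y : R => a * y) a.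
  have := is_deriveM (is_derive_cst a x 1) (is_derive_id x 1).
  by move=> h; apply: is_derive_eq; rewrite /GRing.scale/= mulr1 mulr0 addr0.
have dE := is_derive_chain (is_deriveN (lin eps)) (is_derive_expR _).
have dS := is_derive_chain (lin w) (is_derive_sin _).
have dC := is_derive_chain (lin w) (is_derive_cos _).
have dSw := is_deriveM (is_derive_cst w x 1) dS.
have dCe := is_deriveM (is_derive_cst eps x 1) dC.
have dB := is_deriveM (is_deriveB dSw dCe) (is_derive_cst (eps ^+ 2 + w ^+ 2)^-1 x 1).
have dF := is_deriveM dE (is_deriveD (is_derive_cst (- eps^-1) x 1) dB).
apply: is_derive_eq dF _.
rewrite /GRing.scale/= !fctE/=.
have e0 : eps != 0 by rewrite gt_eqF.
have s0 : eps ^+ 2 + w ^+ 2 != 0 by rewrite gt_eqF// ltr_pwDl ?sqr_ge0// exprn_gt0.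
by field; rewrite e0 s0.
Qed.

Let primitive_cvg w : primitive w x @[x --> +oo] --> 0.
Proof.
have cE : expR (- (eps * x)) @[x --> +oo] --> (0 : R).
  apply: (@cvg_comp _ _ _ (fun x : R => eps * x) (fun y => expR (- y)) _ +oo%R).
    by apply: gt0_cvgMry => //; exact: cvg_id.
  exact: cvgr_expR.
pose C := eps^-1 + (`|w| + eps) / (eps ^+ 2 + w ^+ 2).
have s0 : 0 < eps ^+ 2 + w ^+ 2 by rewrite ltr_pwDl ?sqr_ge0// exprn_gt0.
have bound x : `|primitive w x| <= expR (- (eps * x)) * C.
  rewrite /primitive normrM ger0_norm ?expR_ge0// ler_wpM2l ?expR_ge0//.
  apply: le_trans (ler_normD _ _) _; apply: lerD.
    by rewrite normrN ger0_norm// invr_ge0 ltW.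
  rewrite normrM [X in _ * X <= _]ger0_norm ?invr_ge0 ?(ltW s0)//.
  rewrite ler_wpM2r ?invr_ge0 ?(ltW s0)//.
  apply: le_trans (ler_normB _ _) _; apply: lerD; rewrite normrM.
    by rewrite ler_piMr// ler_norml sin_geN1 sin_le1.
  by rewrite (gtr0_norm eps_gt0) ler_piMr ?(ltW eps_gt0)// ler_norml cos_geN1 cos_le1.
have cC : expR (- (eps * x)) * C @[x --> +oo] --> (0 : R).
  by rewrite -[X in _ --> X](mul0r C); apply: cvgM => //; exact: cvg_cst.
apply: (@squeeze_cvgr _ _ _ _ (fun x => - (expR (- (eps * x)) * C))
  (fun x => expR (- (eps * x)) * C)) => //.
  by near=> x; rewrite -ler_norml.
by rewrite -oppr0; exact: cvgN.
Unshelve. all: by end_near. Qed.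

(* [1 + cos] instead of [cos]: the improper fundamental theorem of calculus in the
   library is for nonnegative functions. *)
Lemma integral_exp_decay_1Dcos w :
  (\int[lam]_x (exp_decay x * (1 + cos (w * x)))%:E =
   (2 * (eps^-1 + eps / (eps ^+ 2 + w ^+ 2)))%:E)%E.
Proof.
have cf : continuous (fun x => expR (- (eps * x)) * (1 + cos (w * x))).
  move=> x; apply: cvgM.
    apply: continuous_comp; last exact: continuous_expR.
    by apply: cvgN; apply: cvgM; [exact: cvg_cst|exact: cvg_id].
  apply: cvgD; first exact: cvg_cst.
  apply: continuous_comp; last exact: continuous_cos.
  by apply: cvgM; [exact: cvg_cst|exact: cvg_id].
have c0 x : 0 <= 1 + cos (w * x) by rewrite addrC -lerBlDr sub0r cos_geN1.
rewrite ge0_symfun_integralT//.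
- rewrite EFinM; congr (_ * _)%E.
  transitivity (\int[lam]_(x in `[0%R, +oo[) (expR (- (eps * x)) * (1 + cos (w * x)))%:E)%E.
    rewrite -set_itvcy; apply: eq_integral => x.
    by rewrite inE/= in_itv/= andbT /exp_decay => /ger0_norm ->.
  rewrite (@ge0_continuous_FTC2y _ _ (primitive w) _ 0).
  + rewrite /primitive !mulr0 oppr0 expR0 sin0 cos0 mul1r mulr0 mulr1 sub0r.
    by rewrite -EFinB sub0r opprD opprK mulNr opprK.
  + by move=> x _; rewrite mulr_ge0 ?expR_ge0.
  + exact: continuous_subspaceT.
  + exact: primitive_cvg.
  + by move=> x _; have [] := is_derive_primitive w x.
  + apply: cvg_at_right_filter; apply: differentiable_continuous.
    by apply/derivable1_diffP; have [] := is_derive_primitive w 0.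
  + by move=> x _; rewrite derive1E; have [_ ->] := is_derive_primitive w x.
- by move=> x; rewrite mulr_ge0 ?exp_decay_ge0.
- move=> x; apply: cvgM; first exact: continuous_exp_decay.
  apply: cvgD; first exact: cvg_cst.
  apply: continuous_comp; last exact: continuous_cos.
  by apply: cvgM; [exact: cvg_cst|exact: cvg_id].
- by move=> x /=; rewrite /exp_decay normrN mulrN cosN.
Qed.

Lemma integral_exp_decay : (\int[lam]_x (exp_decay x)%:E = (2 / eps)%:E)%E.
Proof.
(* For w = 0 the factor 1 + cos is the constant 2, so this is twice the wanted integral. *)
have := integral_exp_decay_1Dcos 0.
under eq_integral do rewrite mul0r cos0 mulrC EFinM.
rewrite ge0_integralZl//; last 2 first.
- by apply/measurable_EFinP; exact: measurable_exp_decay.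
- by move=> x _; rewrite lee_fin exp_decay_ge0.
move=> H; have := congr1 (fun z => (2^-1)%:E * z)%E H.
rewrite muleA -EFinM mulVf// mul1e => ->.
rewrite -EFinM; congr EFin.
by field; rewrite gt_eqF.
Qed.

Lemma integrable_exp_decay (k : R -> R) : measurable_fun setT k ->
  (forall x, `|k x| <= 1) ->
  lam.-integrable setT (fun x => (exp_decay x * k x)%:E).
Proof.
move=> mk k1; apply: (@le_integrable _ _ _ lam setT measurableT _ (EFin \o exp_decay)).
- apply/measurable_EFinP; apply: measurable_funM => //; exact: measurable_exp_decay.
- move=> x _ /=; rewrite lee_fin normrM ler_piMr//.
- apply/integrableP; split; first by apply/measurable_EFinP; exact: measurable_exp_decay.
  under eq_integral do rewrite /= ger0_norm ?exp_decay_ge0//.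
  by rewrite integral_exp_decay ltry.
Qed.

Let measurable_lin w : measurable_fun setT (fun x : R => w * x).
Proof. exact: measurable_funM. Qed.

Lemma integral_exp_decay_cos w :
  (\int[lam]_x (exp_decay x * cos (w * x))%:E = (2 * eps / (eps ^+ 2 + w ^+ 2))%:E)%E.
Proof.
have := integral_exp_decay_1Dcos w.
under eq_integral do rewrite mulrDr EFinD.
rewrite integralD//; last 2 first.
- by apply: integrable_exp_decay => // x; rewrite normr1.
- apply: integrable_exp_decay.
    apply: (measurableT_comp _ (measurable_lin w)).
    by apply: continuous_measurable_fun; exact: continuous_cos.
  by move=> x; rewrite ler_norml cos_geN1 cos_le1.
under eq_integral do rewrite mulr1.
rewrite integral_exp_decay => H.
have := congr1 (fun z => z - (2 / eps)%:E)%E H.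
rewrite addeAC subee// add0e => ->.
by rewrite -EFinB; congr EFin; rewrite mulrDr addrAC subrr add0r mulrA.
Qed.

Lemma integral_exp_decay_sin w :
  (\int[lam]_x (exp_decay x * sin (w * x))%:E = 0)%E.
Proof.
have ms : measurable_fun setT (fun x => sin (w * x)).
  apply: (measurableT_comp _ (measurable_lin w)).
  by apply: continuous_measurable_fun; exact: continuous_sin.
have i1 : lam.-integrable setT (fun x => (exp_decay x * sin (w * x))%:E).
  by apply: integrable_exp_decay => // x; rewrite ler_norml sin_geN1 sin_le1.
have mN : measurable_fun setT (-%R : measurableTypeR R -> measurableTypeR R).
  by apply: (@continuous_measurable_fun R -%R); exact: opp_continuous.
have E : (\int[lam]_x (exp_decay x * sin (w * x))%:E =
          - \int[lam]_x (exp_decay x * sin (w * x))%:E)%E.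
  transitivity (\int[pushforward lam (-%R : measurableTypeR R -> measurableTypeR R)]_x
      (exp_decay x * sin (w * x))%:E)%E.
    apply: (@eq_measure_integral _ _ _ setT
      (pushforward lam (-%R : measurableTypeR R -> measurableTypeR R))) => A mA _.
    exact/esym/lebesgue_measureN.
  rewrite (@integral_pushforward _ _ _ _ _ _ mN lam setT)//.
  - rewrite preimage_setT -integralN.
      by apply: eq_integral => x _; rewrite /= /exp_decay normrN mulrN sinN mulrN EFinN.
    apply: fin_num_adde_defr; exact: integrable_pos_fin_num.
  - by case/integrableP : i1.
  - rewrite preimage_setT (_ : _ \o _ = fun x => (exp_decay x * - sin (w * x))%:E).
      apply: integrable_exp_decay; first exact: measurableT_comp.
      by move=> x; rewrite normrN ler_norml sin_geN1 sin_le1.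
    by apply/funext => x /=; rewrite /exp_decay normrN mulrN sinN.
have /fineK I_fin := integrable_fin_num measurableT i1.
move: E; rewrite -I_fin -EFinN => -[]; move: (fine _) => r rN; congr EFin.
by lra.
Qed.

End poisson_kernel.

(** * Transforms of product functions *)

Section fourier_prod_fun.
Context {R : realType}.
Notation lam := (@lebesgue_measure R).
Notation lamn n := (@lebesgue_tuple R n).
Variables (h k : R -> R) (c : R).
Hypotheses (mh : measurable_fun setT h) (h0 : forall x, 0 <= h x)
  (hc : (\int[lam]_x (h x)%:E = c%:E)%E).
Hypothesis hcos : forall w, (\int[lam]_x (h x * cos (w * x))%:E = (k w)%:E)%E.
Hypothesis hsin : forall w, (\int[lam]_x (h x * sin (w * x))%:E = 0)%E.

Definition tdot n (w : 'I_n -> R) (t : n.-tuple R) : R := \sum_(i < n) w i * tnth t i.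

Lemma tdot_tcons n (w : 'I_n.+1 -> R) x (t : n.-tuple R) :
  tdot w (tcons (x, t)) = w ord0 * x + tdot (fun i => w (lift ord0 i)) t.
Proof.
rewrite /tdot big_ord_recl tnth0; congr (_ + _).
by apply: eq_bigr => i _; rewrite tnthS.
Qed.

Lemma measurable_tdot n (w : 'I_n -> R) : measurable_fun [set: n.-tuple R] (tdot w).
Proof.
by apply: measurable_sum => i; apply: measurable_funM => //; exact: measurable_tnth.
Qed.

Lemma measurable_cos_tdot n (w : 'I_n -> R) :
  measurable_fun [set: n.-tuple R] (fun t => cos (tdot w t)).
Proof.
apply: (measurableT_comp _ (measurable_tdot w)).
by apply: continuous_measurable_fun; exact: continuous_cos.
Qed.

Lemma measurable_sin_tdot n (w : 'I_n -> R) :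
  measurable_fun [set: n.-tuple R] (fun t => sin (tdot w t)).
Proof.
apply: (measurableT_comp _ (measurable_tdot w)).
by apply: continuous_measurable_fun; exact: continuous_sin.
Qed.

Lemma integrable_prod_funM n (g : n.-tuple R -> R) :
  measurable_fun setT g -> (forall t, `|g t| <= 1) ->
  (lamn n).-integrable setT (fun t => (prod_fun h t * g t)%:E).
Proof.
move=> mg g1.
apply: (@le_integrable _ _ _ (lamn n) setT measurableT _ (EFin \o prod_fun h)).
- apply/measurable_EFinP; apply: measurable_funM => //; exact: measurable_prod_fun.
- by move=> t _ /=; rewrite lee_fin normrM ler_piMr.
- exact: integrable_prod_fun hc.
Qed.

Lemma norm_cos_le1 (x : R) : `|cos x| <= 1. Proof. by rewrite ler_norml cos_geN1 cos_le1. Qed.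
Lemma norm_sin_le1 (x : R) : `|sin x| <= 1. Proof. by rewrite ler_norml sin_geN1 sin_le1. Qed.

Let measurable_lin (f : R -> R) (w : R) :
  continuous f -> measurable_fun setT (fun x : R => f (w * x)).
Proof.
move=> cf; apply: (measurableT_comp (continuous_measurable_fun cf)).
exact: measurable_funM.
Qed.

Let integrable_hM (g : R -> R) : measurable_fun setT g -> (forall x, `|g x| <= 1) ->
  lam.-integrable setT (fun x => (h x * g x)%:E).
Proof.
move=> mg g1.
apply: (@le_integrable _ _ _ lam setT measurableT _ (EFin \o h)).
- by apply/measurable_EFinP; exact: measurable_funM.
- by move=> t _ /=; rewrite lee_fin normrM ler_piMr.
- apply/integrableP; split; first exact/measurable_EFinP.
  by under eq_integral do rewrite /= ger0_norm//; rewrite hc ltry.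
Qed.

(** The addition formulas mix cosine and sine, so both integrals go through the induction together.
    As the one-variable sine integrals vanish, only the product of cosine transforms survives. *)
Lemma fourier_prod_fun n (w : 'I_n -> R) :
  (\int[lamn n]_t (prod_fun h t * cos (tdot w t))%:E = (\prod_(i < n) k (w i))%:E)%E /\
  (\int[lamn n]_t (prod_fun h t * sin (tdot w t))%:E = 0)%E.
Proof.
elim: n w => [|n ih] w.
  split.
    rewrite [LHS](_ : _ = \int[dirac [tuple]]_(t in [set: 0.-tuple R]) (cst 1%:E t))%E.
      by rewrite integral_dirac// diracT mul1e big_ord0.
    by apply: eq_integral => t _; rewrite /prod_fun /tdot !big_ord0 cos0 mulr1.
  rewrite (eq_integral (cst 0%E)) ?integral0// => t _.
  by rewrite /tdot !big_ord0 sin0 mulr0.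
pose w' i := w (lift ord0 i); have [ihc ihs] := ih w'.
have icos := integrable_prod_funM (measurable_cos_tdot w') (fun t => norm_cos_le1 _).
have isin := integrable_prod_funM (measurable_sin_tdot w') (fun t => norm_sin_le1 _).
(* Integral over the last n coordinates with the first frozen at x. The pair (a, b) is (cos, -sin)
   of [w ord0 * x] for the cosine of a sum and (sin, cos) for the sine. *)
have inner (a b x : R) : (\int[lamn n]_t
    (h x * (a * (prod_fun h t * cos (tdot w' t)) + b * (prod_fun h t * sin (tdot w' t))))%:E =
    ((\prod_(i < n) k (w' i)) * (h x * a))%:E)%E.
  under eq_integral do rewrite mulrDr EFinD !mulrA -2!(mulrA (h x * _)) (EFinM (h x * a)) (EFinM (h x * b)).
  rewrite integralD//; [|exact: integrableZl|exact: integrableZl].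
  by rewrite !integralZl// ihc ihs mule0 adde0 -EFinM mulrC.
split.
- rewrite integral_lebesgue_tupleS; last first.
    exact: (integrable_prod_funM (measurable_cos_tdot w) (fun t => norm_cos_le1 _)).
  transitivity (\int[lam]_x (((\prod_(i < n) k (w' i)))%:E * (h x * cos (w ord0 * x))%:E))%E.
    apply: eq_integral => x _; rewrite -EFinM -(inner _ (- sin (w ord0 * x))).
    by apply: eq_integral => t _; rewrite prod_fun_tcons tdot_tcons cosD; congr EFin; ring.
  rewrite integralZl//; last first.
    apply: integrable_hM => [|x]; last exact: norm_cos_le1.
    by apply: (@measurable_lin cos); exact: continuous_cos.
  by rewrite hcos -EFinM big_ord_recl mulrC.
- rewrite integral_lebesgue_tupleS; last first.
    exact: (integrable_prod_funM (measurable_sin_tdot w) (fun t => norm_sin_le1 _)).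
  transitivity (\int[lam]_x (((\prod_(i < n) k (w' i)))%:E * (h x * sin (w ord0 * x))%:E))%E.
    apply: eq_integral => x _; rewrite -EFinM -(inner _ (cos (w ord0 * x))).
    by apply: eq_integral => t _; rewrite prod_fun_tcons tdot_tcons sinD; congr EFin; ring.
  rewrite integralZl//; last first.
    apply: integrable_hM => [|x]; last exact: norm_sin_le1.
    by apply: (@measurable_lin sin); exact: continuous_sin.
  by rewrite hsin mule0.
Qed.

End fourier_prod_fun.

Lemma Rintegral_dominated_cvg {R : realType} (disp : measure_display)
    (T : measurableType disp) (mu : {measure set T -> \bar R})
    (g_ : nat -> T -> R) (g G : T -> R) :
  (forall n, measurable_fun setT (g_ n)) ->
  (forall x, g_ ^~ x @ \oo --> g x) ->
  mu.-integrable setT (EFin \o G) ->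
  (forall n x, `|g_ n x| <= G x) ->
  \int[mu]_x g_ n x @[n --> \oo] --> \int[mu]_x g x.
Proof.
move=> mg_ g_g iG g_G.
have mg : measurable_fun setT g.
  by apply: (@measurable_fun_cvg _ _ _ _ g_) => // x _; exact: g_g.
have cvE x : (EFin \o g_ n) x @[n --> \oo] --> (EFin \o g) x.
  by apply: cvg_EFin; [exact: nearW|exact: g_g].
have [ig _ cv] := @dominated_convergence _ _ _ mu setT measurableT
  (fun n => EFin \o g_ n) (EFin \o g) (EFin \o G)
  (fun n => (measurable_EFinP _ _).2 (mg_ n)) ((measurable_EFinP _ _).2 mg)
  (aeW _ (fun x _ => cvE x)) iG (aeW _ (fun x n _ => g_G n x)).
apply: fine_cvg.
by rewrite fineK//; exact: integrable_fin_num.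
Qed.

Lemma integral_EFinZl {R : realType} (disp : measure_display)
    (T : measurableType disp) (mu : {measure set T -> \bar R}) (f : T -> R) (r : R) :
  mu.-integrable setT (fun x => (f x)%:E) ->
  (\int[mu]_x (r * f x)%:E = (r * \int[mu]_x f x)%:E)%E.
Proof.
move=> fi; under eq_integral do rewrite EFinM.
rewrite integralZl// EFinM fineK//.
by apply: integrable_fin_num.
Qed.

(** * The multiplication formula and inversion at the origin *)

Section inversion.
Context {R : realType} {d : nat}.
Notation lam := (@lebesgue_measure R).
Notation lamn := (@lebesgue_tuple R d).
Implicit Types F : 'cV[R]_d -> R.

Lemma dotC (x y : 'cV[R]_d) : dot x y = dot y x.
Proof. by apply: eq_bigr => i _; rewrite mulrC. Qed.

Lemma dotDl (x y z : 'cV[R]_d) : dot (x + y) z = dot x z + dot y z.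
Proof. by rewrite /dot -big_split/=; apply: eq_bigr => i _; rewrite mxE mulrDl. Qed.

Lemma dotDr (x y z : 'cV[R]_d) : dot z (x + y) = dot z x + dot z y.
Proof. by rewrite ![dot z _]dotC dotDl. Qed.

Lemma dotZl (a : R) (x y : 'cV[R]_d) : dot (a *: x) y = a * dot x y.
Proof. by rewrite /dot mulr_sumr; apply: eq_bigr => i _; rewrite mxE mulrA. Qed.

Lemma dotNl (x y : 'cV[R]_d) : dot (- x) y = - dot x y.
Proof. by rewrite -scaleN1r dotZl mulN1r. Qed.

Lemma dot_vecE (x : 'cV[R]_d) (t : d.-tuple R) :
  2 * pi * dot x (vec t) = tdot (fun i => 2 * pi * x i ord0) t.
Proof. by rewrite /dot mulr_sumr; apply: eq_bigr => i _; rewrite mxE mulrA. Qed.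

(** For [tr] equal to [cos] or [sin] this is the real or the imaginary part of the inverse transform
    of the real function [F]. With [tr] as a parameter, estimates are shared by both parts. *)
Definition osc_integral (tr : R -> R) F (x : 'cV[R]_d) : R :=
  \int[lamn]_t (F (vec t) * tr (2 * pi * dot x (vec t))).

Section regularization.
Variables (tr : R -> R) (mtr : measurable_fun setT tr) (tr1 : forall x, `|tr x| <= 1).

Lemma measurable_osc (x : 'cV[R]_d) : measurable_fun setT (fun t : d.-tuple R => tr (2 * pi * dot x (vec t))).
Proof.
under eq_fun do rewrite dot_vecE.
exact: (measurableT_comp mtr (measurable_tdot _)).
Qed.

Lemma integrable_osc F x : test_function F ->
  lamn.-integrable setT (fun t => (F (vec t) * tr (2 * pi * dot x (vec t)))%:E).
Proof. by move=> tF; apply: integrable_test => //; exact: measurable_osc. Qed.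

(** The multiplication formula: a transform moves from one factor of an integral to the other. The
    exchange is legitimate because the double integrand is dominated by C h(s) q(t), a product of
    integrable functions. *)
Lemma osc_integral_Fubini F (h : R -> R) (c : R) : test_function F ->
  measurable_fun setT h -> (forall x, 0 <= h x) ->
  (\int[lam]_x (h x)%:E = c%:E)%E ->
  (\int[lamn]_s (prod_fun h s * osc_integral tr F (vec s))%:E =
   \int[lamn]_t (F (vec t) *
     \int[lamn]_s (prod_fun h s * tr (2 * pi * dot (vec t) (vec s))))%:E)%E.
Proof.
move=> tF mh h0 hc.
have [C FC] := test_function_weight tF.
pose q : R -> R := fun x => (oneDsqr x)^-1.
have q0 x : 0 <= q x by rewrite invr_ge0.
pose f (p : d.-tuple R * d.-tuple R) : R :=
  prod_fun h p.1 * (F (vec p.2) * tr (2 * pi * dot (vec p.1) (vec p.2))).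
have mF : measurable_fun setT (F \o @vec R d).
  by apply: measurable_continuous_vec; apply: elementary_continuous; case: tF.
have mf : measurable_fun setT f.
  apply: measurable_funM.
    exact: (measurableT_comp (measurable_prod_fun mh) measurable_fst).
  apply: measurable_funM; first exact: (measurableT_comp mF measurable_snd).
  apply: (measurableT_comp mtr); apply: measurable_funM => //.
  apply: measurable_sum => i.
  rewrite (_ : (fun p => _) = fun p : d.-tuple R * d.-tuple R => tnth p.1 i * tnth p.2 i).
    by apply: measurable_funM;
      [exact: (measurableT_comp (measurable_tnth i) measurable_fst)
      |exact: (measurableT_comp (measurable_tnth i) measurable_snd)].
  by apply/funext => p; rewrite !mxE.
have mhq : measurable_fun setT
    (fun p : d.-tuple R * d.-tuple R => prod_fun h p.1 * prod_fun q p.2).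
  apply: measurable_funM.
    exact: (measurableT_comp (measurable_prod_fun mh) measurable_fst).
  exact: (measurableT_comp (measurable_prod_fun measurable_oneDsqrV) measurable_snd).
have ihq : (lamn \x lamn)%E.-integrable setT
    (fun p : d.-tuple R * d.-tuple R => (prod_fun h p.1 * prod_fun q p.2)%:E).
  apply/integrable12ltyP; first exact/measurable_EFinP.
  under eq_integral => s _.
    under eq_integral => t _.
      rewrite /= ger0_norm ?mulr_ge0 ?prod_fun_ge0// EFinM; over.
    rewrite ge0_integralZl//; last 3 first.
    - by apply/measurable_EFinP; exact: (measurable_prod_fun measurable_oneDsqrV).
    - by move=> t _; rewrite lee_fin prod_fun_ge0.
    - by rewrite lee_fin prod_fun_ge0.
    rewrite (integral_prod_fun _ measurable_oneDsqrV q0 integral_oneDsqrV) -EFinM mulrC EFinM.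
    over.
  rewrite ge0_integralZl//; last 3 first.
  - by apply/measurable_EFinP; exact: measurable_prod_fun.
  - by move=> t _; rewrite lee_fin prod_fun_ge0.
  - by rewrite lee_fin exprn_ge0// pi_ge0.
  by rewrite (integral_prod_fun _ mh h0 hc) -EFinM ltry.
have jf : (lamn \x lamn)%E.-integrable setT (EFin \o f).
  apply: (@le_integrable _ _ _ (lamn \x lamn)%E setT measurableT _
    (fun p : d.-tuple R * d.-tuple R => C%:E * (prod_fun h p.1 * prod_fun q p.2)%:E)%E).
  - exact/measurable_EFinP.
  - move=> [s t] _; rewrite /= /f/= lee_fin normrM [leRHS]normrM [`|_ * prod_fun q _|]normrM.
    rewrite (ger0_norm (prod_fun_ge0 _ h0)) (ger0_norm (prod_fun_ge0 _ q0)).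
    rewrite [leRHS]mulrCA ler_wpM2l ?prod_fun_ge0// normrM.
    apply: (@le_trans _ _ `|F (vec t)|); first by rewrite ler_piMr.
    by apply: le_trans (FC t) _; rewrite ler_wpM2r ?prod_fun_ge0// ler_norm.
  - exact: integrableZl.
have FE := Fubini jf.
transitivity (\int[lamn]_s \int[lamn]_t (EFin \o f) (s, t))%E.
  apply: eq_integral => s _; rewrite /= /f/=.
  by rewrite (integral_EFinZl _ (integrable_osc (vec s) tF)).
rewrite FE; apply: eq_integral => t _; rewrite /= /f/=.
have it : lamn.-integrable setT (fun s => (prod_fun h s * tr (2 * pi * dot (vec t) (vec s)))%:E).
  exact: (integrable_prod_funM mh h0 hc (measurable_osc (vec t)) (fun s => tr1 _)).
under eq_integral do rewrite mulrCA (dotC _ (vec t)).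
by rewrite (integral_EFinZl _ it).
Qed.

End regularization.
Lemma measurable_cosR : measurable_fun setT (@cos R).
Proof. by apply: continuous_measurable_fun; exact: continuous_cos. Qed.

Lemma measurable_sinR : measurable_fun setT (@sin R).
Proof. by apply: continuous_measurable_fun; exact: continuous_sin. Qed.

Let poisson (eps w : R) : R := 2 * eps / (eps ^+ 2 + w ^+ 2).

Let fourier_decay (eps : R) (w : 'cV[R]_d) : 0 < eps ->
  (\int[lamn]_s (prod_fun (exp_decay eps) s * cos (2 * pi * dot w (vec s))) =
    \prod_(i < d) poisson eps (2 * pi * w i ord0)) /\
  (\int[lamn]_s (prod_fun (exp_decay eps) s * sin (2 * pi * dot w (vec s))) = 0).
Proof.
move=> e0; have [hc hs] := fourier_prod_fun (measurable_exp_decay eps)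
  (exp_decay_ge0 eps) (integral_exp_decay e0) (integral_exp_decay_cos e0)
  (integral_exp_decay_sin e0) (fun i => 2 * pi * w i ord0).
split; rewrite /Rintegral.
  under eq_integral do rewrite dot_vecE.
  by rewrite hc.
under eq_integral do rewrite dot_vecE.
by rewrite hs.
Qed.

(** This is [poisson 1 (2 * pi * v)]; the 2 pi of the Fourier phase gives it mass 1. *)
Let kernel (v : R) : R := 2 * (oneDsqr (2 * pi * v))^-1.

Let kernel_ge0 v : 0 <= kernel v. Proof. by rewrite mulr_ge0// invr_ge0. Qed.

Let measurable_kernel : measurable_fun setT kernel.
Proof.
apply: measurable_funM => //; apply: (measurableT_comp measurable_oneDsqrV).
exact: measurable_funM.
Qed.

Let integral_kernel : (\int[lam]_v (kernel v)%:E = 1%:E)%E.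
Proof.
have pi2 : 0 < 2 * pi :> R by rewrite mulr_gt0// pi_gt0.
have := @ge0_integral_affine R (2 * pi) 0 (fun x => ((oneDsqr x)^-1)%:E) pi2.
rewrite integral_oneDsqrV => /(_ _ _)/wrap[].
- by apply/measurable_EFinP; exact: measurable_oneDsqrV.
- by move=> x; rewrite lee_fin invr_ge0.
under eq_integral do rewrite addr0.
have mk : measurable_fun setT (fun x : R => ((oneDsqr (2 * pi * x))^-1)%:E).
  apply/measurable_EFinP; apply: (measurableT_comp measurable_oneDsqrV).
  exact: measurable_funM.
have k0 (x : R) : (0 <= ((oneDsqr (2 * pi * x))^-1)%:E)%E by rewrite lee_fin invr_ge0.
move=> /(congr1 (fun z => (pi^-1)%:E * z)%E).
rewrite muleA -!EFinM mulVf ?gt_eqF ?pi_gt0// mulrCA mulVf ?gt_eqF ?pi_gt0// mulr1 => ->.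
rewrite -ge0_integralZl//; by apply: eq_integral => x _; rewrite -EFinM.
Qed.

(** Substituting eps t for t moves the parameter from the kernel into [F], so that the limit can be
    taken by dominated convergence against one fixed kernel. *)
Let scaled_kernel (eps : R) F : 0 < eps -> test_function F ->
  \int[lamn]_t (F (vec t) * \prod_(i < d) poisson eps (2 * pi * (vec t) i ord0)) =
  \int[lamn]_t (F (eps *: vec t) * prod_fun kernel t).
Proof.
move=> e0 tF.
have mp : measurable_fun setT (fun x => poisson eps (2 * pi * x)).
  apply: continuous_measurable_fun => x; apply: cvgM; first exact: cvg_cst.
  apply: cvgV.
    by rewrite gt_eqF// ltr_pwDl ?sqr_ge0// exprn_gt0.
  apply: cvgD; first exact: cvg_cst.
  apply: (@continuous_comp _ _ _ (fun x => 2 * pi * x) (fun y => y ^+ 2)).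
    by apply: cvgM; [exact: cvg_cst|exact: cvg_id].
  exact: exprn_continuous.
have prodE (t : d.-tuple R) : \prod_(i < d) poisson eps (2 * pi * (vec t) i ord0) =
    prod_fun (fun x => poisson eps (2 * pi * x)) t.
  by apply: eq_bigr => i _; rewrite mxE.
have p0 x : 0 <= poisson eps (2 * pi * x).
  by rewrite /poisson divr_ge0 ?addr_ge0 ?sqr_ge0// mulr_ge0// ltW.
have [C FC] := test_function_weight tF.
(* Each Poisson factor 2 eps / (eps^2 + y^2) is at most 2 / eps, which explains the constant
   below. *)
have ig : lamn.-integrable setT
    (EFin \o (fun t => F (vec t) * prod_fun (fun x => poisson eps (2 * pi * x)) t)).
  apply: (@integrable_weighted _ _ (C * (2 / eps) ^+ d)).
    apply: measurable_funM; last exact: measurable_prod_fun.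
    by apply: measurable_continuous_vec; apply: elementary_continuous; case: tF.
  move=> t; rewrite normrM mulrAC ler_pM//.
  rewrite ger0_norm ?prod_fun_ge0// /prod_fun.
  rewrite (_ : (2 / eps) ^+ d = \prod_(i < d) (2 / eps)); last first.
    by rewrite prodr_const card_ord.
  apply: ler_prod => i _; rewrite p0/= /poisson.
  have s0 : 0 < eps ^+ 2 + (2 * pi * tnth t i) ^+ 2.
    by rewrite ltr_pwDl ?sqr_ge0// exprn_gt0.
  rewrite ler_pdivrMr// -[leRHS]mulrA ler_wpM2l// ler_pdivlMl// -expr2 lerDl.
  by rewrite sqr_ge0.
under eq_Rintegral do rewrite prodE.
rewrite (Rintegral_affine_tuple (fun=> 0) e0 ig).
have ig' := integrable_affine_tuple (fun=> 0) e0 ig.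
rewrite -RintegralZl//; apply: eq_Rintegral => t _.
have -> : vec (affine_tuple eps (fun=> 0) t) = eps *: vec t.
  by apply/colP => i; rewrite !mxE tnth_mktuple addr0.
rewrite mulrCA; congr (_ * _).
rewrite (_ : eps ^+ d = \prod_(i < d) eps); last by rewrite prodr_const card_ord.
rewrite /prod_fun -big_split/=; apply: eq_bigr => i _.
rewrite tnth_mktuple addr0 /poisson /kernel /oneDsqr.
have s1 : 1 + (2 * pi * tnth t i) ^+ 2 != 0 by rewrite gt_eqF// ltr_pwDl ?sqr_ge0.
have -> : eps ^+ 2 + (2 * pi * (eps * tnth t i)) ^+ 2 = eps ^+ 2 * (1 + (2 * pi * tnth t i) ^+ 2).
  by ring.
move: s1; move: (1 + _) => S S0; field; rewrite S0.
by rewrite gt_eqF.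
Qed.

Let eps_ (n : nat) : R := n.+1%:R^-1.

Let eps_gt0 n : 0 < eps_ n. Proof. by rewrite invr_gt0 ltr0n. Qed.

Let eps_cvg : eps_ n @[n --> \oo] --> 0.
Proof.
apply/cvgrPdist_lt => e e0; near=> n; rewrite sub0r normrN gtr0_norm//.
near: n; exact: (near_infty_natSinv_lt (PosNum e0)).
Unshelve. all: by end_near. Qed.

Let kernel_limit F : test_function F ->
  \int[lamn]_t (F (eps_ n *: vec t) * prod_fun kernel t) @[n --> \oo] --> F 0.
Proof.
move=> tF.
have cF : continuous F by apply: elementary_continuous; case: tF.
have [M FM] := test_function_bounded tF.
rewrite [X in _ --> X](_ : F 0 = \int[lamn]_t (F 0 * prod_fun kernel t)); last first.
  rewrite RintegralZl//; last exact: integrable_prod_fun integral_kernel.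
  by rewrite /Rintegral (integral_prod_fun _ measurable_kernel kernel_ge0 integral_kernel)/= expr1n mulr1.
apply: (@Rintegral_dominated_cvg _ _ _ _ _ _ (fun t => M * prod_fun kernel t)).
- move=> n; apply: measurable_funM; last exact: measurable_prod_fun.
  apply: (@measurable_continuous_vec _ _ (fun x => F (eps_ n *: x))) => x.
  have c1 := @scaler_continuous _ _ (eps_ n) x.
  have c2 := cF (eps_ n *: x).
  exact (cvg_comp _ _ c1 c2).
- move=> t; apply: cvgM; last exact: cvg_cst.
  have c : eps_ n *: vec t @[n --> \oo] --> (0 : 'cV[R]_d).
    by rewrite -[X in _ --> X](scale0r (vec t)); exact: cvgZr_tmp.
  exact (cvg_comp _ _ c (cF 0)).
- apply: (@eq_integrable _ _ _ _ setT measurableT (fun t => M%:E * (prod_fun kernel t)%:E)%E) => //.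
  apply: integrableZl => //; exact: integrable_prod_fun integral_kernel.
- move=> n t; rewrite normrM [X in _ * X]ger0_norm ?prod_fun_ge0//.
  by rewrite ler_wpM2r ?prod_fun_ge0.
Qed.

Let exp_limit (T : d.-tuple R -> R) : lamn.-integrable setT (EFin \o T) ->
  \int[lamn]_s (prod_fun (exp_decay (eps_ n)) s * T s) @[n --> \oo] --> \int[lamn]_s T s.
Proof.
move=> iT.
have mT : measurable_fun setT T by apply/measurable_EFinP; case/integrableP : iT.
apply: (@Rintegral_dominated_cvg _ _ _ _ _ _ (fun t => `|T t|)).
- move=> n; apply: measurable_funM => //.
  exact: measurable_prod_fun (measurable_exp_decay _).
- move=> s; rewrite -[X in _ --> X]mul1r; apply: cvgM; last exact: cvg_cst.
  rewrite /prod_fun; elim: (index_enum _) => [|i r ih].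
    by under eq_cvg do rewrite big_nil; exact: cvg_cst.
  under eq_cvg do rewrite big_cons.
  have c : - (eps_ n * `|tnth s i|) @[n --> \oo] --> 0.
    rewrite -oppr0 -(mul0r `|tnth s i|); apply: cvgN; apply: cvgM => //.
    exact: cvg_cst.
  have c1 : exp_decay (eps_ n) (tnth s i) @[n --> \oo] --> (1 : R).
    by rewrite -expR0; exact (cvg_comp _ _ c (@continuous_expR R 0)).
  by have := cvgM c1 ih; rewrite mulr1 => /(_ _) H; exact: H.
- by rewrite (_ : EFin \o _ = abse \o (EFin \o T))//; exact: integrable_abse.
- move=> n t; rewrite normrM ler_piMl//.
  rewrite ger0_norm ?prod_fun_ge0//; last by move=> x; exact: exp_decay_ge0.
  apply: prodr_ile1 => i _; rewrite exp_decay_ge0/= /exp_decay.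
  by rewrite -expR0 ler_expR oppr_le0 mulr_ge0// ltW.
Qed.

(** The multiplication formula with h = [exp_decay] identifies the sequences of [exp_limit] and
    [kernel_limit]; comparing their limits gives the claim. Other frequencies are reached later by
    translating [F]. *)
Lemma inversion_at0 F : test_function F ->
  lamn.-integrable setT (fun s => (osc_integral cos F (vec s))%:E) ->
  \int[lamn]_s osc_integral cos F (vec s) = F 0.
Proof.
move=> tF iT; have L1 := exp_limit iT; have L2 := kernel_limit tF.
suff E : (fun n => \int[lamn]_s (prod_fun (exp_decay (eps_ n)) s * osc_integral cos F (vec s))) =
    (fun n => \int[lamn]_t (F (eps_ n *: vec t) * prod_fun kernel t)).
  by rewrite E in L1; rewrite -(cvg_lim (@Rhausdorff R) L1) (cvg_lim (@Rhausdorff R) L2).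
apply/funext => n; rewrite -scaled_kernel// /Rintegral.
rewrite (osc_integral_Fubini measurable_cosR (@norm_cos_le1 R) tF
  (measurable_exp_decay _) (exp_decay_ge0 _) (integral_exp_decay (eps_gt0 n))).
congr fine; apply: eq_integral => t _; congr (_ * _)%:E.
by have [-> _] := fourier_decay (vec t) (eps_gt0 n).
Qed.

(** Here every regularized integral is already 0, since the damping factor is even and its sine
    transform vanishes. *)
Lemma inversion_at0_sin F : test_function F ->
  lamn.-integrable setT (fun s => (osc_integral sin F (vec s))%:E) ->
  \int[lamn]_s osc_integral sin F (vec s) = 0.
Proof.
move=> tF iT; have L1 := exp_limit iT.
suff E : (fun n => \int[lamn]_s (prod_fun (exp_decay (eps_ n)) s * osc_integral sin F (vec s))) =
    (fun=> 0).
  rewrite E in L1; rewrite -(cvg_lim (@Rhausdorff R) L1).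
  by apply: cvg_lim; [exact: Rhausdorff|exact: cvg_cst].
apply/funext => n; rewrite /Rintegral.
rewrite (osc_integral_Fubini measurable_sinR (@norm_sin_le1 R) tF
  (measurable_exp_decay _) (exp_decay_ge0 _) (integral_exp_decay (eps_gt0 n))).
rewrite (eq_integral (cst 0%E)) ?integral0// => t _.
by have [_ ->] := fourier_decay (vec t) (eps_gt0 n); rewrite mulr0.
Qed.

End inversion.

(** * Decay and smoothness of inverse Fourier transforms *)

Section mean_value.
Context {R : realType}.

Lemma mean_value (f df : R -> R) (a b : R) : (forall x : R, is_derive x 1 f (df x)) ->
  exists2 c, `|c - a| <= `|b - a| & f b - f a = df c * (b - a).
Proof.
move=> fD.
have cf : continuous f.
  by move=> x; apply/differentiable_continuous/derivable1_diffP; case: (fD x).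
have mvt u v : u <= v -> exists2 c, c \in `[u, v]%R & f v - f u = df c * (v - u).
  move=> uv; apply: MVT_segment => //.
  exact: continuous_subspaceT.
have [ab|ba] := leP a b.
  have [c /[!in_itv]/= /andP[ac cb] E] := mvt _ _ ab.
  exists c => //; rewrite !ger0_norm ?subr_ge0//; by rewrite lerD2r.
have [c /[!in_itv]/= /andP[bc ca] E] := mvt _ _ (ltW ba).
exists c; last by rewrite -opprB E -mulrN opprB.
by rewrite distrC [leRHS]distrC !ger0_norm ?subr_ge0 ?(ltW ba)// lerD2l lerN2.
Qed.

Lemma cos_lipschitz (a b : R) : `|cos b - cos a| <= `|b - a|.
Proof.
have [c _ ->] := mean_value a b (@is_derive_cos R).
by rewrite normrM ler_piMl// normrN norm_sin_le1.
Qed.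

Lemma sin_lipschitz (a b : R) : `|sin b - sin a| <= `|b - a|.
Proof.
have [c _ ->] := mean_value a b (@is_derive_sin R).
by rewrite normrM ler_piMl// norm_cos_le1.
Qed.

(** The mean value theorem followed by the Lipschitz bound for the derivative gives the constant 1,
    which suffices for [is_derive_quadratic]. *)
Lemma cos_taylor1 (a h : R) : `|cos (a + h) - cos a + h * sin a| <= h ^+ 2.
Proof.
have [c ca ->] := mean_value a (a + h) (@is_derive_cos R).
rewrite addrAC subrr add0r in ca *.
rewrite mulNr (mulrC (sin c)) -mulrN -mulrDr addrC normrM -(real_normK (num_real h)) expr2.
rewrite ler_wpM2l// distrC; exact: le_trans (sin_lipschitz _ _) ca.
Qed.

Lemma sin_taylor1 (a h : R) : `|sin (a + h) - sin a - h * cos a| <= h ^+ 2.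
Proof.
have [c ca ->] := mean_value a (a + h) (@is_derive_sin R).
rewrite addrAC subrr add0r in ca *.
rewrite (mulrC (cos c)) -mulrBr normrM -(real_normK (num_real h)) expr2.
rewrite ler_wpM2l//; exact: le_trans (cos_lipschitz _ _) ca.
Qed.

Lemma is_derive_along {V : normedModType R} (f : V -> R) (x v : V) (u df : R) :
  is_derive (u *: v + x) v f df -> is_derive u 1 (fun t : R => f (t *: v + x)) df.
Proof.
have E : (fun h : R => h^-1 *: ((f \o shift (u *: v + x)) (h *: v) - f (u *: v + x))) =
         (fun h : R => h^-1 *: (((fun t : R => f (t *: v + x)) \o shift u)
            (h *: (1 : R)) - f (u *: v + x))).
  by apply/funext => h /=; rewrite [_%:A]mulr1 scalerDl addrA.
by move=> -[fD <-]; split; [move: fD; rewrite /derivable E|rewrite /derive E].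
Qed.

End mean_value.

Section osc_integrals.
Context {R : realType} {d : nat}.
Notation lamn := (@lebesgue_tuple R d).
Implicit Types (F G H : 'cV[R]_d -> R) (x : 'cV[R]_d) (i : 'I_d).

Lemma integrable_test_function F : test_function F ->
  lamn.-integrable setT (EFin \o (F \o vec)).
Proof.
move=> tF; have [C FC] := test_function_weight tF.
apply: integrable_weighted FC; apply: measurable_continuous_vec.
by apply: elementary_continuous; case: tF.
Qed.

Lemma integrable_test_norm F : test_function F ->
  lamn.-integrable setT (fun t => `|F (vec t)|%:E).
Proof. by move=> /integrable_test_function/integrable_abse. Qed.

Lemma Rintegral_shift F (c : 'cV[R]_d) : lamn.-integrable setT (EFin \o (F \o vec)) ->
  \int[lamn]_t F (vec t + c) = \int[lamn]_t F (vec t).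
Proof.
move=> iF; have := Rintegral_affine_tuple (fun i => c i ord0) ltr01 iF.
rewrite expr1n mul1r => ->; apply: eq_Rintegral => t _ /=; congr F.
by apply/colP => i; rewrite !mxE tnth_mktuple mul1r.
Qed.

Lemma test_function_coord F i : test_function F -> test_function (fun x => x i ord0 * F x).
Proof. by move=> tF; apply: test_functionM => //; exact: elementary_coord. Qed.

Lemma test_functionZ a F : test_function F -> test_function (fun x => a * F x).
Proof. by move=> tF; apply: test_functionM => //; exact: elementary_cst. Qed.

(* By translation invariance the difference quotients of [H] have integral 0. *)
Lemma integral_partial_eq0 H G i : test_function H -> test_function G ->
  (forall x, is_derive x (delta_mx i ord0) H (G x)) ->
  \int[lamn]_t G (vec t) = 0.
Proof.
move=> tH tG HG; have [M GM] := test_function_bounded tG.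
have [_ [B HB]] := tH.
pose e n : R := n.+1%:R^-1.
have e_gt0 n : 0 < e n by rewrite invr_gt0 ltr0n.
have e_le1 n : e n <= 1 by rewrite invf_le1// ler1n.
have e_cvg : e n @[n --> \oo] --> 0.
  apply/cvgrPdist_lt => r r0; near=> n; rewrite sub0r normrN gtr0_norm//.
  near: n; exact: (near_infty_natSinv_lt (PosNum r0)).
pose q n x : R := (e n)^-1 * (H (x + e n *: delta_mx i ord0) - H x).
have tq n : test_function (q n).
  apply: test_functionZ; apply: test_functionD; first exact: test_function_shift.
  rewrite (_ : (fun x => - H x) = fun x => -1 * H x); first exact: test_functionZ.
  by apply/funext => x; rewrite mulN1r.
have q0 n : \int[lamn]_t q n (vec t) = 0.
  rewrite RintegralZl//; last first.
    have := integrable_test_function (test_functionZ (e n) (tq n)).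
    apply: eq_integrable => // t _ /=.
    by rewrite mulrA mulfV ?mul1r// gt_eqF.
  rewrite RintegralB//; last 2 first.
  - exact: (integrable_test_function (test_function_shift (e n *: delta_mx i ord0) tH)).
  - exact: integrable_test_function.
  by rewrite Rintegral_shift ?subrr ?mulr0//; exact: integrable_test_function.
have q_bound n x : `|q n x| <= M.
  have [c _ E] := mean_value 0 (e n) (fun u => is_derive_along (HG (u *: delta_mx i ord0 + x))).
  rewrite /q [x + _]addrC; move: E; rewrite scale0r add0r subr0 => ->.
  by rewrite mulrCA mulVf ?gt_eqF// mulr1.
(* The step [e n] is at most 1, so enlarging the box by 1 works for all n at once. *)
have q_supp n x j : B + 1 < `|x j ord0| -> q n x = 0.
  move=> xB; rewrite /q.
  have Bx : B < `|x j ord0| by apply: lt_trans xB; rewrite ltrDl.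
  rewrite (HB x j Bx) (HB _ j) ?subrr ?mulr0// !mxE eqxx andbT.
  rewrite -ltrBrDr in xB; apply: lt_le_trans xB _.
  rewrite lerBlDr (@le_trans _ _ (`|x j ord0 + e n * (j == i)%:R| + `|e n * (j == i)%:R|))//.
    by rewrite -[in leLHS](addrK (e n * (j == i)%:R) (x j ord0)) ler_normB.
  rewrite lerD2l normrM gtr0_norm//; case: (j == i); last by rewrite normr0 mulr0.
  by rewrite normr1 mulr1.
have cv : \int[lamn]_t q n (vec t) @[n --> \oo] --> \int[lamn]_t G (vec t).
  have DC := (@Rintegral_dominated_cvg _ _ _ lamn (fun n (t : d.-tuple R) => q n (vec t)) (fun t : d.-tuple R => G (vec t))
    (fun t : d.-tuple R => M * (1 + (B + 1) ^+ 2) ^+ d * prod_fun (fun x : R => (oneDsqr x)^-1) t)).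
  apply: DC.  
  - move=> n; apply: measurable_continuous_vec.
    by apply: elementary_continuous; case: (tq n).
  - move=> t.
    have [dH <-] := HG (vec t).
    move/cvg_ex : dH => [l Hl]; rewrite /derive (cvg_lim _ Hl)//.
    have [+ _] := cvgr_dnbhsP (fun h : R => h^-1 *: ((H \o shift (vec t)) (h *: delta_mx i ord0) - H (vec t))) 0 l.
    move=> /(_ Hl e)/(_ (conj (fun n => lt0r_neq0 (e_gt0 n)) e_cvg)).
    rewrite (_ : (fun n => _) = fun n => q n (vec t))//.
    by apply/funext => n; rewrite /q /= [_ *: _ + _]addrC.
  - apply: (@eq_integrable _ _ _ _ setT measurableT (fun t => (M * (1 + (B + 1) ^+ 2) ^+ d)%:E *
      (prod_fun (fun x : R => (oneDsqr x)^-1) t)%:E)%E) => //.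
    apply: integrableZl => //.
    apply: (integrable_prod_fun _ measurable_oneDsqrV _ integral_oneDsqrV) => x.
    by rewrite invr_ge0.
  - move=> n t; exact: (bounded_box_weight (q_bound n) (q_supp n)).
have : \int[lamn]_t q n (vec t) @[n --> \oo] --> 0.
  by under eq_cvg do rewrite q0; exact: cvg_cst.
by move=> /(cvg_lim (@Rhausdorff R)) <-; rewrite (cvg_lim (@Rhausdorff R) cv).
Unshelve. all: by end_near. Qed.

Implicit Types tr dtr : R -> R.

Lemma osc_integralD tr F G x :
  measurable_fun setT tr -> (forall y : R, `|tr y| <= 1) ->
  test_function F -> test_function G ->
  osc_integral tr (fun y => F y + G y) x = osc_integral tr F x + osc_integral tr G x.
Proof.
move=> mtr tr1 tF tG; rewrite /osc_integral -RintegralD//; last 2 first.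
- exact: integrable_osc.
- exact: integrable_osc.
by apply: eq_Rintegral => t _; rewrite mulrDl.
Qed.

Lemma osc_integralZ tr a F x :
  measurable_fun setT tr -> (forall y : R, `|tr y| <= 1) -> test_function F ->
  osc_integral tr (fun y => a * F y) x = a * osc_integral tr F x.
Proof.
move=> mtr tr1 tF; rewrite /osc_integral -RintegralZl//; last exact: integrable_osc.
by apply: eq_Rintegral => t _; rewrite mulrA.
Qed.

Lemma osc_integral_bounded tr F :
  measurable_fun setT tr -> (forall y : R, `|tr y| <= 1) -> test_function F ->
  exists M : R, forall x, `|osc_integral tr F x| <= M.
Proof.
move=> mtr tr1 tF; exists (\int[lamn]_t `|F (vec t)|) => x.
have io := integrable_osc mtr tr1 x tF.
apply: le_trans (le_normr_Rintegral _ io) _ => //.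
apply: le_Rintegral => //.
- exact: (integrable_abse io).
- exact: integrable_test_norm.
- by move=> t _; rewrite normrM ler_piMr.
Qed.

Lemma norm_osc_diff_le tr F P (c : R) x y :
  measurable_fun setT tr -> (forall y : R, `|tr y| <= 1) -> test_function F -> test_function P ->
  (forall t, `|F (vec t) * (tr (2 * pi * dot y (vec t)) - tr (2 * pi * dot x (vec t)))|
     <= c * `|P (vec t)|) ->
  `|osc_integral tr F y - osc_integral tr F x| <= c * \int[lamn]_t `|P (vec t)|.
Proof.
move=> mtr tr1 tF tP H.
have iP := integrable_test_norm tP.
have io z := integrable_osc mtr tr1 z tF.
rewrite /osc_integral -(RintegralB measurableT (io y) (io x)) -(RintegralZl c measurableT iP).
have iD : lamn.-integrable setT (fun t =>
   (F (vec t) * tr (2 * pi * dot y (vec t)) - F (vec t) * tr (2 * pi * dot x (vec t)))%:E).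
  exact: (integrableB measurableT (io y) (io x)).
apply: le_trans (le_normr_Rintegral _ iD) _ => //.
apply: le_Rintegral => //.
- exact: (integrable_abse iD).
- exact: (integrableZl measurableT c iP).
- by move=> t _; rewrite -mulrBr.
Qed.

Lemma le_coord_norm x i : `|x i ord0| <= `|x|.
Proof.
rewrite [leRHS]/Num.norm/= mx_normrE.
exact: (le_bigmax _ (fun ij => `|x ij.1 ij.2|) (i, ord0)).
Qed.

Lemma osc_integral_continuous tr F :
  measurable_fun setT tr -> (forall y : R, `|tr y| <= 1) ->
  (forall a b, `|tr b - tr a| <= `|b - a|) -> test_function F ->
  continuous (osc_integral tr F).
Proof.
move=> mtr tr1 trL tF x.
(* The Lipschitz bound produces the weight |y_i|. Majorizing it by the polynomial 1 + y_i^2 keeps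
   [P] a test function. *)
pose P (y : 'cV[R]_d) : R := (2 * pi * \sum_(i < d) (1 + y i ord0 * y i ord0)) * F y.
have tP : test_function P.
  apply: test_functionM => //; apply: elementaryM; first exact: elementary_cst.
  by apply: elementary_sum => i; do ![constructor].
set K := \int[lamn]_t `|P (vec t)|.
have K0 : 0 <= K by apply: Rintegral_ge0.
have LK y : `|osc_integral tr F x - osc_integral tr F y| <= `|x - y| * K.
  apply: norm_osc_diff_le => // t.
  rewrite normrM /P (mulrC _ (F _)) [`|F (vec t) * _|]normrM mulrCA ler_wpM2l//.
  apply: le_trans (trL _ _) _; rewrite -mulrBr -dotNl -dotDl.
  rewrite normrM [`|2 * pi * \sum_(i < d) _|]normrM [leRHS]mulrCA ler_wpM2l//.
  apply: le_trans (ler_norm_sum _ _ _) _.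
  rewrite (ger0_norm (sumr_ge0 _ _)); last first.
    by move=> i _; rewrite -expr2 addr_ge0// sqr_ge0.
  rewrite mulr_sumr; apply: ler_sum => i _.
  rewrite normrM ler_pM// ?le_coord_norm//; move: (vec t i ord0) => z.
  rewrite ler_norml; have := sqr_ge0 (z - 2^-1); have := sqr_ge0 (z + 2^-1).
  by move=> ? ?; apply/andP; split; nra.
apply/(@cvgrPdist_le _ _ _ (nbhs x) (nbhs_filter x)) => e e0; near=> y; apply: le_trans (LK y) _.
rewrite (@le_trans _ _ (`|x - y| * (K + 1)))// ?ler_wpM2l ?lerDl//.
rewrite -ler_pdivlMr ?ltr_wpDl//; near: y; apply: cvgr_dist_le => //.
by rewrite divr_gt0// ltr_wpDl.
Unshelve. all: by end_near. Qed.

(** Moving x by h along the i-th axis changes the phase by 2 pi h t_i. The Taylor bound at this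
    increment integrates to h^2 times the integral of |(2 pi t_i)^2 F|, a quadratic remainder. *)
Lemma is_derive_osc tr dtr F x i :
  measurable_fun setT tr -> (forall y : R, `|tr y| <= 1) ->
  measurable_fun setT dtr -> (forall y : R, `|dtr y| <= 1) ->
  (forall a h, `|tr (a + h) - tr a - h * dtr a| <= h ^+ 2) -> test_function F ->
  is_derive x (delta_mx i ord0) (osc_integral tr F)
    (2 * pi * osc_integral dtr (fun y => y i ord0 * F y) x).
Proof.
move=> mtr tr1 mdtr dtr1 taylor tF.
have tF1 := test_function_coord i tF.
have tF2 := test_functionZ ((2 * pi) ^+ 2) (test_function_coord i tF1).
apply: (@is_derive_quadratic _ _ _ _ _ _
  (\int[lamn]_t `|(2 * pi) ^+ 2 * (vec t i ord0 * (vec t i ord0 * F (vec t)))|)) => h _.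
set x' := h *: _ + x.
have i1 := integrable_osc mtr tr1 x' tF.
have i2 := integrable_osc mtr tr1 x tF.
have i3 := integrable_osc mdtr dtr1 x tF1.
have i12 := integrableB measurableT i1 i2.
rewrite /osc_integral mulrA -RintegralZl//.
have i3' := integrableZl measurableT (h * (2 * pi)) i3.
rewrite -(RintegralB measurableT i1 i2) -(RintegralB measurableT i12 i3').
have iD := integrableB measurableT i12 i3'.
apply: le_trans (le_normr_Rintegral measurableT iD) _ => //.
rewrite [leRHS]mulrC -(RintegralZl (h ^+ 2) measurableT (integrable_test_norm tF2)).
apply: le_Rintegral => //.
- exact: (integrable_abse iD).
- exact: (integrableZl measurableT (h ^+ 2) (integrable_test_norm tF2)).
move=> t _ /=.
have -> : 2 * pi * dot x' (vec t) = 2 * pi * dot x (vec t) + h * (2 * pi * vec t i ord0).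
  rewrite /x' dotDl dotZl addrC mulrDr; congr (_ + _); rewrite mulrCA; congr (h * (_ * _)).
  rewrite /dot (bigD1 i)//= big1 ?addr0 ?mxE ?eqxx ?mul1r// => j ji.
  by rewrite !mxE (negbTE ji) mul0r.
set a := 2 * pi * dot _ _; set b := vec t i ord0; set f := F _.
rewrite (_ : _ - _ = f * (tr (a + h * (2 * pi * b)) - tr a - h * (2 * pi * b) * dtr a)); last by ring.
rewrite [leLHS]normrM (_ : (2 * pi) ^+ 2 * (b * (b * f)) = f * (2 * pi * b) ^+ 2); last by ring.
rewrite [`|f * _ ^+ 2|]normrM [leRHS]mulrCA ler_wpM2l//; apply: le_trans (taylor _ _) _.
by rewrite exprMn ger0_norm ?sqr_ge0.
Qed.

End osc_integrals.

(** * Stability of the transforms, and inversion at every frequency *)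

Section osc_functions.
Context {R : realType} {d : nat}.
Notation lamn := (@lebesgue_tuple R d).
Implicit Types (F G H : 'cV[R]_d -> R) (x y : 'cV[R]_d) (i : 'I_d) (w : 'cV[R]_d -> R).

Let mcos := @measurable_cosR R.
Let msin := @measurable_sinR R.
Let cos1 := @norm_cos_le1 R.
Let sin1 := @norm_sin_le1 R.

(** With th(y) = 2 pi x.y, the i-th partial derivatives of F sin(th) and F cos(th) have integral 0;
    expanding them by the product rule gives the two identities. *)
Lemma osc_integral_parts F G x i : test_function F -> test_function G ->
  (forall y, is_derive y (delta_mx i ord0) F (G y)) ->
  2 * pi * x i ord0 * osc_integral cos F x = - osc_integral sin G x /\
  2 * pi * x i ord0 * osc_integral sin F x = osc_integral cos G x.
Proof.
move=> tF tG FG.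
pose th y := 2 * pi * dot x y.
have eth : elementary th.
  rewrite (_ : th = fun y => 2 * pi * dot y x); last first.
    by apply/funext => y; rewrite /th dotC.
  by apply: elementaryM; [exact: elementary_cst|exact: elementary_dot].
have dth y : is_derive y (delta_mx i ord0) th (2 * pi * x i ord0).
  apply: (@is_derive_quadratic _ _ _ _ _ _ 0) => t _.
  rewrite /th dotDr (dotC x) dotZl.
  rewrite (_ : dot (delta_mx i ord0) x = x i ord0); last first.
    rewrite /dot (bigD1 i)//= big1 ?addr0 ?mxE ?eqxx ?mul1r// => j ji.
    by rewrite !mxE (negbTE ji) mul0r.
  by rewrite (_ : _ - _ = 0) ?normr0 ?mul0r//; ring.
have tM (h : R -> R) K : elementary (fun y => h (th y)) -> test_function K ->
    test_function (fun y => K y * h (th y)).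
  move=> eh tK; rewrite (_ : (fun y => _) = fun y => h (th y) * K y).
    exact: test_functionM.
  by apply/funext => y; rewrite mulrC.
(* The class [elementary] contains cosines and sines so that the product of a test function with the
   phase is again a test function. *)
have ec : elementary (fun y => cos (th y)) by exact: elementary_cos.
have es : elementary (fun y => sin (th y)) by exact: elementary_sin.
have [pc ps] : test_function (fun y => F y * cos (th y)) /\ test_function (fun y => F y * sin (th y)).
  by split; exact: tM.
have osc0 (tr : R -> R) (a : R) : measurable_fun setT tr -> (forall y : R, `|tr y| <= 1) ->
    osc_integral tr F x * a = \int[lamn]_t (a * (F (vec t) * tr (th (vec t)))).
  by move=> mtr tr1; rewrite RintegralZl 1?mulrC//; exact: integrable_osc.
set a := 2 * pi * x i ord0.
split.
- have tD : test_function (fun y => G y * sin (th y) + a * (F y * cos (th y))).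
    by apply: test_functionD; [exact: tM|exact: test_functionZ].
  have D0 : \int[lamn]_t (G (vec t) * sin (th (vec t)) + a * (F (vec t) * cos (th (vec t)))) = 0.
    apply: (integral_partial_eq0 ps tD) => y.
    have := is_deriveM (FG y) (is_derive_chain (dth y) (is_derive_sin _)).
    by move=> D; apply: is_derive_eq; rewrite /GRing.scale/= /a; ring.
  rewrite RintegralD// in D0; last 2 first.
  + exact: (integrable_osc msin sin1 x tG).
  + exact: (integrable_test_function (test_functionZ a pc)).
  rewrite -osc0// in D0.
  by rewrite mulrC; apply/eqP; rewrite -addr_eq0 addrC; apply/eqP.
- have tD : test_function (fun y => G y * cos (th y) - a * (F y * sin (th y))).
    rewrite (_ : (fun y => _) = fun y => G y * cos (th y) + - a * (F y * sin (th y))).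
      by apply: test_functionD; [exact: tM|exact: test_functionZ].
    by apply/funext => y; rewrite mulNr.
  have D0 : \int[lamn]_t (G (vec t) * cos (th (vec t)) - a * (F (vec t) * sin (th (vec t)))) = 0.
    apply: (integral_partial_eq0 pc tD) => y.
    have := is_deriveM (FG y) (is_derive_chain (dth y) (is_derive_cos _)).
    by move=> D; apply: is_derive_eq; rewrite /GRing.scale/= /a; ring.
  rewrite RintegralB// in D0; last 2 first.
  + exact: (integrable_osc mcos cos1 x tG).
  + exact: (integrable_test_function (test_functionZ a ps)).
  rewrite -osc0// in D0.
  by rewrite mulrC; apply/eqP; rewrite eq_sym -subr_eq0; apply/eqP.
Qed.

(** Both a cosine and a sine part are allowed, because differentiation and multiplication by a
    coordinate exchange the two. *)
Definition osc_function w := exists F G, [/\ test_function F, test_function G &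
  forall x, w x = osc_integral cos F x + osc_integral sin G x].

Lemma test_function0 : @test_function R d (fun=> 0).
Proof. by split; [exact: elementary_cst|exists 0]. Qed.

Lemma osc_integral0 (tr : R -> R) x : osc_integral tr (fun=> 0) x = 0 :> R.
Proof.
rewrite /osc_integral (_ : (fun t => _) = fun=> 0).
  by rewrite /Rintegral integral0.
by apply/funext => t; rewrite mul0r.
Qed.

Lemma osc_function_cos F : test_function F -> osc_function (osc_integral cos F).
Proof.
move=> tF; exists F, (fun=> 0); split => // [|x]; first exact: test_function0.
by rewrite osc_integral0 addr0.
Qed.

Lemma osc_function_sin F : test_function F -> osc_function (osc_integral sin F).
Proof.
move=> tF; exists (fun=> 0), F; split => // [|x]; first exact: test_function0.
by rewrite osc_integral0 add0r.
Qed.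

Lemma osc_functionD w w' : osc_function w -> osc_function w' ->
  osc_function (fun x => w x + w' x).
Proof.
move=> [F [G [tF tG wE]]] [F' [G' [tF' tG' wE']]].
exists (fun y => F y + F' y), (fun y => G y + G' y); split; try exact: test_functionD.
by move=> x; rewrite wE wE' !osc_integralD// addrACA.
Qed.

Lemma osc_function_coord i w : osc_function w -> osc_function (fun x => x i ord0 * w x).
Proof.
move=> [F [G [tF tG wE]]].
have [F' tF' FF'] := test_function_derive i tF.
have [G' tG' GG'] := test_function_derive i tG.
(* The identities of [osc_integral_parts] solved for the coordinate: the sine part [G] yields the
   new cosine part and [F] the new sine part. *)
exists (fun y => (2 * pi)^-1 * G' y), (fun y => - (2 * pi)^-1 * F' y).
split; try exact: test_functionZ.
move=> x; rewrite wE !osc_integralZ//.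
have [E _] := osc_integral_parts x tF tF' FF'.
have [_ E'] := osc_integral_parts x tG tG' GG'.
rewrite -E' mulNr -mulrN -E.
have pi0 : pi != 0 :> R by rewrite gt_eqF// pi_gt0.
move: pi0 (osc_integral cos F x) (osc_integral sin G x); move: pi => p p0 A B.
by field.
Qed.

Lemma osc_function_derive i w : osc_function w ->
  exists2 w', osc_function w' & forall x, is_derive x (delta_mx i ord0) w (w' x).
Proof.
move=> [F [G [tF tG wE]]].
have tF' := test_functionZ (- (2 * pi)) (test_function_coord i tF).
have tG' := test_functionZ (2 * pi) (test_function_coord i tG).
exists (fun x => osc_integral cos (fun y => 2 * pi * (y i ord0 * G y)) x +
    osc_integral sin (fun y => - (2 * pi) * (y i ord0 * F y)) x).
  by exists (fun y => 2 * pi * (y i ord0 * G y)), (fun y => - (2 * pi) * (y i ord0 * F y)).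
move=> x; rewrite (_ : w = fun x => osc_integral cos F x + osc_integral sin G x); last exact/funext.
rewrite addrC; apply: is_deriveD.
- have nsin : measurable_fun setT (fun y : R => - sin y) by exact: measurableT_comp.
  have nsin1 (y : R) : `|- sin y| <= 1 by rewrite normrN.
  have := is_derive_osc x i mcos cos1 nsin nsin1 _ tF.
  have tay (a h : R) : `|cos (a + h) - cos a - h * - sin a| <= h ^+ 2.
    by rewrite mulrN opprK cos_taylor1.
  move=> /(_ tay); rewrite osc_integralZ//; last exact: test_function_coord.
  move=> D; apply: is_derive_eq; rewrite mulNr -mulrN; congr (_ * _).
  rewrite /osc_integral -mulN1r -RintegralZl//; last exact: integrable_osc (test_function_coord i tF).
  by apply: eq_Rintegral => t _; rewrite mulrN mulN1r.
- rewrite osc_integralZ//; last exact: test_function_coord.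
  by apply: is_derive_osc => //; exact: sin_taylor1.
Qed.

Lemma osc_function_continuous w : osc_function w -> continuous w.
Proof.
move=> [F [G [tF tG wE]]].
rewrite (_ : w = fun x => osc_integral cos F x + osc_integral sin G x); last exact/funext.
move=> x.
have c1 := @osc_integral_continuous _ _ _ _ mcos cos1 (@cos_lipschitz R) tF x.
have c2 := @osc_integral_continuous _ _ _ _ msin sin1 (@sin_lipschitz R) tG x.
exact: (cvgD c1 c2).
Qed.

Lemma osc_function_bounded w : osc_function w -> exists M : R, forall x, `|w x| <= M.
Proof.
move=> [F [G [tF tG wE]]].
have [M FM] := osc_integral_bounded mcos cos1 tF.
have [N GN] := osc_integral_bounded msin sin1 tG.
by exists (M + N) => x; rewrite wE (le_trans (ler_normD _ _))// lerD.
Qed.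

Lemma osc_function_partials w (I : seq 'I_d) : osc_function w -> osc_function (partials I w).
Proof.
move=> ow; elim: I => [//|i I ih] /=.
have [g og Hg] := osc_function_derive i ih.
rewrite (_ : (fun x => _) = g)//.
by apply/funext => x; exact: (@derive_val _ _ _ _ _ _ _ (Hg x)).
Qed.

Lemma osc_function_smooth w : osc_function w -> smooth_real w.
Proof.
move=> ow I; have oI := osc_function_partials I ow; split.
  exact: osc_function_continuous.
by move=> i x; have [g _ /(_ x)[]] := osc_function_derive i oI.
Qed.

Lemma osc_function_sum J (r : seq J) (W : J -> 'cV[R]_d -> R) :
  (forall j, osc_function (W j)) -> osc_function (fun x => \sum_(j <- r) W j x).
Proof.
move=> oW; elim: r => [|j r ih].
  under eq_fun do rewrite big_nil.
  exists (fun=> 0), (fun=> 0); split; try exact: test_function0.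
  by move=> x; rewrite !osc_integral0 addr0.
by under eq_fun do rewrite big_cons; exact: osc_functionD.
Qed.

(** The polynomial (1 + |x|^2)^k times any partial derivative stays in the class, hence is bounded;
    and |x| <= 1 + |x|^2. *)
Lemma osc_function_schwartz w : osc_function w -> schwartz_real w.
Proof.
move=> ow; split; first exact: osc_function_smooth.
move=> k I; have oI := osc_function_partials I ow.
have {oI}/osc_function_bounded[M HM] :
    osc_function (fun x => (1 + dot x x) ^+ k * partials I w x).
  elim: k => [|k ih]; first by under eq_fun do rewrite expr0 mul1r.
  rewrite (_ : (fun x => _) = fun x => (1 + dot x x) ^+ k * partials I w x +
    \sum_(i < d) x i ord0 * (x i ord0 * ((1 + dot x x) ^+ k * partials I w x))).
    apply: osc_functionD => //; apply: osc_function_sum => i.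
    by do 2! apply: osc_function_coord.
  apply/funext => x; rewrite exprS -mulrA mulrDl mul1r; congr (_ + _).
  set c := _ ^+ k * _; rewrite /dot mulr_suml; apply: eq_bigr => i _; by rewrite mulrA.
exists M => x; apply: le_trans (HM x).
have q0 : 0 <= dot x x by apply: sumr_ge0 => i _; rewrite -expr2 sqr_ge0.
rewrite normrM ler_wpM2r// ger0_norm ?exprn_ge0 ?addr_ge0//.
rewrite lerXn2r ?nnegrE ?sqrtr_ge0 ?addr_ge0// /enorm.
have := sqr_sqrtr q0; have := sqrtr_ge0 (dot x x).
by move: (Num.sqrt _) => a; move: (dot x x) => b a0 <-; nra.
Qed.

(** The reciprocal of the integrable majorant is a polynomial, so its product with [w] stays in the
    class and is bounded. *)
Lemma osc_function_integrable w : osc_function w ->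
  lamn.-integrable setT (fun t => (w (vec t))%:E).
Proof.
move=> ow.
have : osc_function (fun x => (\prod_(i < d) (1 + x i ord0 ^+ 2)) * w x).
  elim: (index_enum _) => [|i r ih].
    by under eq_fun do rewrite big_nil mul1r.
  under eq_fun do rewrite big_cons -mulrA mulrDl mul1r expr2 -mulrA.
  by apply: osc_functionD => //; do 2! apply: osc_function_coord.
move=> /osc_function_bounded[M HM].
apply: (@integrable_weighted _ _ M).
  exact: measurable_continuous_vec (osc_function_continuous ow).
move=> t; have := HM (vec t).
have P0 : 0 < \prod_(i < d) (1 + vec t i ord0 ^+ 2).
  by apply: prodr_gt0 => i _; rewrite ltr_pwDl// sqr_ge0.
rewrite normrM (gtr0_norm P0) mulrC -ler_pdivlMr// /prod_fun prodfV.
rewrite (_ : \prod_(i < d) oneDsqr (tnth t i) = \prod_(i < d) (1 + vec t i ord0 ^+ 2))//.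
by apply: eq_bigr => i _; rewrite mxE.
Qed.

Local Open Scope complex_scope.

Definition inverse_fourier F x : R[i] := osc_integral cos F x +i* osc_integral sin F x.

(** Real and imaginary parts of one law: multiplying the inverse transform by exp(-2 pi i xi.x)
    translates [F] by xi. This reduces inversion at xi to inversion at 0. *)
Lemma osc_integral_shift F (xi x : 'cV[R]_d) : test_function F ->
  osc_integral cos F x * cos (2 * pi * dot xi x) + osc_integral sin F x * sin (2 * pi * dot xi x) =
    osc_integral cos (fun y => F (y + xi)) x /\
  osc_integral sin F x * cos (2 * pi * dot xi x) - osc_integral cos F x * sin (2 * pi * dot xi x) =
    osc_integral sin (fun y => F (y + xi)) x.
Proof.
move=> tF.
have ic := integrable_osc mcos cos1 x tF.
have is_ := integrable_osc msin sin1 x tF.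
set a := cos (2 * pi * dot xi x); set b := sin (2 * pi * dot xi x).
have ica := integrableZl measurableT a ic.
have icb := integrableZl measurableT b ic.
have isa := integrableZl measurableT a is_.
have isb := integrableZl measurableT b is_.
have E (tr : R -> R) : measurable_fun setT tr -> (forall y : R, `|tr y| <= 1) ->
    osc_integral tr (fun y => F (y + xi)) x =
    \int[lamn]_t (F (vec t) * tr (2 * pi * dot x (vec t) - 2 * pi * dot xi x)).
  move=> mtr tr1.
  pose g y := F y * tr (2 * pi * dot x y - 2 * pi * dot xi x).
  rewrite -[RHS](@Rintegral_shift _ _ g xi); last first.
    apply: integrable_test => //.
    apply: (measurableT_comp mtr); apply: measurable_funB => //.
    under eq_fun do rewrite dot_vecE; exact: measurable_tdot.
  apply: eq_Rintegral => t _; rewrite /g; congr (_ * tr _).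
  by rewrite dotDr [2 * pi * (dot _ _ + _)]mulrDr (dotC xi x) addrK.
rewrite !E//.
rewrite /osc_integral mulrC [X in _ + X]mulrC -!RintegralZl//.
split.
- rewrite -(RintegralD measurableT ica isb); apply: eq_Rintegral => t _ /=.
  by rewrite cosB -/a -/b; ring.
- rewrite mulrC [X in _ - X]mulrC -!RintegralZl// -(RintegralB measurableT isa icb).
  apply: eq_Rintegral => t _ /=.
  by rewrite sinB -/a -/b; ring.
Qed.

Lemma fourier_inverse_fourier F xi : test_function F ->
  fourier (inverse_fourier F) xi = (F xi)%:C.
Proof.
move=> tF; rewrite /fourier /integral_Rd /inverse_fourier /cis.
have tFx := test_function_shift xi tF.
congr (_ +i* _).
- have := inversion_at0 tFx (osc_function_integrable (osc_function_cos tFx)).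
  rewrite add0r => <-; apply: eq_Rintegral => t _ /=.
  rewrite cosN sinN mulrN opprK.
  by have [-> _] := osc_integral_shift xi (vec t) tF.
- rewrite -(inversion_at0_sin tFx (osc_function_integrable (osc_function_sin tFx))).
  apply: eq_Rintegral => t _ /=.
  rewrite cosN sinN mulrN addrC.
  by have [_ ->] := osc_integral_shift xi (vec t) tF.
Qed.

Lemma schwartz_inverse_fourier F : test_function F -> schwartz (inverse_fourier F).
Proof.
move=> tF; split; apply: osc_function_schwartz.
- exact: osc_function_cos.
- exact: osc_function_sin.
Qed.

Lemma smooth_inverse_fourier F : test_function F -> smooth (inverse_fourier F).
Proof.
move=> tF; split; apply: osc_function_smooth.
- exact: osc_function_cos.
- exact: osc_function_sin.
Qed.

Lemma integrable_inverse_fourier F : test_function F -> integrable_Rd (inverse_fourier F).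
Proof.
move=> tF; split; apply: osc_function_integrable.
- exact: osc_function_cos.
- exact: osc_function_sin.
Qed.

End osc_functions.

(** * The construction *)

Lemma box_compact {R : realType} {d : nat} (B : R) :
  compact [set x : 'cV[R]_d | forall i, `|x i ord0| <= B].
Proof.
have ctr : continuous (fun v : 'rV[R]_d => v^T).
  move=> /= v A /= /(nbhs_ballP v^T)[e e0 eA].
  apply/nbhs_ballP; exists e => //= w [_ vw]; apply: eA; split => // i j.
  by rewrite !mxE; exact: vw.
have bc := @rV_compact R d (fun=> `[- B, B]%classic) (fun=> @segment_compact R (- B) B).
have := continuous_compact (continuous_subspaceT ctr) bc.
congr compact; apply/seteqP; split => [x [v vB <-] i|x xB] /=.
  by rewrite mxE ler_norml; have := vB i; rewrite /= in_itv.
exists x^T; last exact: trmxK.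
by move=> i; rewrite /= in_itv/= mxE -ler_norml.
Qed.

Lemma compact_support_test_function {R : realType} {d : nat} (F : 'cV[R]_d -> R) :
  test_function F -> compact (closure [set x | F x != 0]).
Proof.
move=> [_ [B FB]].
have cB := @box_compact R d B.
have clB : closed [set x : 'cV[R]_d | forall i, `|x i ord0| <= B].
  by apply: compact_closed => //; exact: norm_hausdorff.
apply: (subclosed_compact _ cB); first exact: closed_closure.
rewrite ((closure_id _).1 clB); apply: closure_subset => x /= Fx i.
by rewrite leNgt; apply/negP => /FB F0; rewrite F0 eqxx in Fx.
Qed.

Lemma periodic_int {R : realType} {tr : R -> R} (p : R) (z : int) (a : R) :
  (forall b, tr (b + p) = tr b) -> tr (a + p * z%:~R) = tr a.
Proof.
move=> trp.
have nat_case (n : nat) b : tr (b + p * n%:R) = tr b.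
  elim: n => [|n ih]; first by rewrite mulr0 addr0.
  by rewrite -natr1 mulrDr mulr1 addrA trp ih.
case: z => n; first by rewrite -[in RHS](nat_case n).
by rewrite -[LHS](nat_case n.+1) NegzE mulrNz mulrN addrNK.
Qed.

(** * Translation by vectors that pair integrally with x *)

Section translates.
Context {R : realType} {d : nat}.
Notation lamn := (@lebesgue_tuple R d).
Implicit Types (F : 'cV[R]_d -> R) (x c e : 'cV[R]_d).
Variables (tr : R -> R) (mtr : measurable_fun setT tr) (tr1 : forall y, `|tr y| <= 1).
Hypothesis tr2pi : forall b, tr (b + 2 * pi) = tr b.

(** Translation by c multiplies the inverse transform at x by exp(2 pi i c.x), which is 1 when c.x
    is an integer. *)
Lemma osc_integral_translate F c x (z : int) : test_function F -> dot c x = z%:~R ->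
  osc_integral tr (fun y => F (y - c)) x = osc_integral tr F x.
Proof.
move=> tF cx.
pose g y := F (y - c) * tr (2 * pi * dot x y).
rewrite /osc_integral -[LHS](@Rintegral_shift _ _ g c); last first.
  exact: (integrable_osc mtr tr1 x (test_function_shift (- c) tF)).
apply: eq_Rintegral => t _; rewrite /g addrK dotDr (dotC x c) cx; congr (_ * _).
by rewrite [2 * pi * (dot _ _ + _)]mulrDr periodic_int.
Qed.

Lemma osc_integral_cancel (phi0 phi1 phi2 : 'cV[R]_d -> R) e x (z : int) :
  test_function phi0 -> test_function phi1 -> test_function phi2 ->
  (forall y, phi0 y + phi1 y + phi2 y = 0) -> dot e x = z%:~R ->
  osc_integral tr (fun y => phi0 y + phi1 (y - e) + phi2 (y - (e + e))) x = 0.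
Proof.
move=> t0 t1 t2 S0 ex.
have t1' := test_function_shift (- e) t1.
have t2' := test_function_shift (- (e + e)) t2.
rewrite osc_integralD//; last exact: test_functionD.
rewrite osc_integralD// (osc_integral_translate t1 ex).
rewrite (@osc_integral_translate _ _ _ (z + z) t2); last by rewrite dotDl ex intrD.
rewrite -!osc_integralD//; last exact: test_functionD.
rewrite /osc_integral; under eq_Rintegral do rewrite S0 mul0r.
by rewrite /Rintegral integral0.
Qed.

End translates.

(** * The spectra of f and of its fractional Laplacian *)

Section construction.
Context {R : realType} {d : nat}.
Variables (s : R) (e : 'cV[R]_d).
Hypotheses (s_gt0 : 0 < s) (e_gt0 : 0 < dot e e).
Implicit Types x : 'cV[R]_d.

Definition sqdist x c : R := dot (x - c) (x - c).

(** Positive exactly on the open ball of radius |e| around e. Squared distances keep the argument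
    polynomial. *)
Definition cutoff x : R := flat_powR 0 (dot e e - sqdist x e).

(* [pweight s j = |x + j e|^(2 s) * pweight 0 j] is smooth even at [x = - j e],
   where the power alone need not be. *)
Definition pweight (a : R) (j : nat) x : R := flat_powR a (sqdist x (- (e *+ j))).

(** Write w_j for [pweight 0 j] and p_j for |x + j e|^(2s), so that [pweight s j] is p_j w_j. For
    {j, k, l} = {0, 1, 2} and a = 0 this is [cutoff] w_0 w_1 w_2 (p_l - p_k); thus the bump K is
    [cutoff] w_0 w_1 w_2. For a = s there is a further factor p_j. *)
Definition component (a : R) (j k l : nat) x : R :=
  cutoff x * (pweight a j x * (pweight 0 k x * pweight s l x - pweight s k x * pweight 0 l x)).

Definition spectrum (a : R) x : R :=
  component a 0 1 2 x + component a 1 2 0 (x - e) + component a 2 0 1 (x - (e + e)).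

Lemma elementary_sqdist c : elementary (fun x => sqdist x c).
Proof. exact: (elementary_shift (- c) elementary_sqnorm). Qed.

Lemma test_function_cutoff : test_function cutoff.
Proof.
split.
  apply: elementary_flat; apply: elementaryB; first exact: elementary_cst.
  exact: elementary_sqdist.
(* With r = [dot e e] and the sup norm of e, this bound forces |x_i - e_i| >= 1 + r, and (1 + r)^2
   >= r. *)
exists (`|e| + (1 + dot e e)) => x i xB.
rewrite /cutoff flat_powR_le0// subr_le0.
have ei := le_coord_norm e i.
have xe : 1 + dot e e <= `|(x - e) i ord0|.
  rewrite !mxE; have := lerB_dist (x i ord0) (e i ord0); lra.
apply: (@le_trans _ _ (`|(x - e) i ord0| ^+ 2)); first by nra.
rewrite real_normK ?num_real// /sqdist /dot (bigD1 i)//= expr2 lerDl.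
by apply: sumr_ge0 => j _; rewrite -expr2 sqr_ge0.
Qed.

Lemma test_function_component a j k l : test_function (component a j k l).
Proof.
have ew b m : elementary (pweight b m).
  by apply: elementary_flat; exact: elementary_sqdist.
rewrite (_ : component a j k l = fun x => (pweight a j x *
    (pweight 0 k x * pweight s l x - pweight s k x * pweight 0 l x)) * cutoff x).
  apply: test_functionM test_function_cutoff.
  by apply: elementaryM => //; apply: elementaryB; exact: elementaryM.
by apply/funext => x; rewrite mulrC.
Qed.

Lemma test_function_spectrum a : test_function (spectrum a).
Proof.
apply: test_functionD; first apply: test_functionD.
- exact: test_function_component.
- exact: (test_function_shift (- e) (test_function_component a 1 2 0)).
- exact: (test_function_shift (- (e + e)) (test_function_component a 2 0 1)).
Qed.

(** Up to the cutoff, the cyclic sum is the 3 x 3 determinant with rows [pweight a], [pweight 0] and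
    [pweight s]; for these two values of a two rows coincide. *)
Lemma component_sum a x : a = 0 \/ a = s ->
  component a 0 1 2 x + component a 1 2 0 x + component a 2 0 1 x = 0.
Proof.
rewrite /component => -[] ->.
all: move: (cutoff x) (pweight 0 0 x) (pweight 0 1 x) (pweight 0 2 x) => c w0 w1 w2.
all: by move: (pweight s 0 x) (pweight s 1 x) (pweight s 2 x) => P0 P1 P2; ring.
Qed.

Lemma sqdist_ge0 x c : 0 <= sqdist x c.
Proof. by apply: sumr_ge0 => i _; rewrite -expr2 sqr_ge0. Qed.

Lemma enorm_powR x : enorm x `^ (2 * s) = dot x x `^ s.
Proof.
have q0 : 0 <= dot x x by apply: sumr_ge0 => i _; rewrite -expr2 sqr_ge0.
by rewrite powRrM /enorm powR_mulrn ?sqrtr_ge0// sqr_sqrtr.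
Qed.

(** At x - j e the j-th weight sees |x - j e + j e| = |x|, so after translation every component
    carries the same factor |x|^(2s). *)
Lemma component_translate j k l x :
  component s j k l (x - e *+ j) = enorm x `^ (2 * s) * component 0 j k l (x - e *+ j).
Proof.
rewrite /component enorm_powR.
have -> : pweight s j (x - e *+ j) = dot x x `^ s * pweight 0 j (x - e *+ j).
  rewrite /pweight flat_powRM ?sqdist_ge0 ?gt_eqF//; congr (_ `^ _ * _).
  by rewrite /sqdist opprK subrK.
by rewrite -(mulrA (dot x x `^ s)) mulrCA.
Qed.

Lemma spectrum_powR x : spectrum s x = enorm x `^ (2 * s) * spectrum 0 x.
Proof.
rewrite /spectrum !mulrDr.
have := component_translate 0 1 2 x; rewrite mulr0n subr0 => ->.
have := component_translate 1 2 0 x; rewrite mulr1n => ->.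
by have := component_translate 2 0 1 x; rewrite mulr2n => ->.
Qed.

Lemma spectrum_neq0 : spectrum 0 e != 0.
Proof.
have dotN (x : 'cV[R]_d) : dot (- x) (- x) = dot x x by rewrite dotNl dotC dotNl opprK.
have dotn n : dot (e *+ n) (e *+ n) = n%:R ^+ 2 * dot e e.
  by rewrite -scaler_nat dotZl dotC dotZl mulrA expr2.
(* The origin lies on the boundary sphere of the cutoff ball, where [flat_powR 0 0] is 0. *)
have c1 : cutoff (e - e) = 0.
  by rewrite /cutoff /sqdist subrr sub0r dotN subrr flat_powR_le0.
have c2 : cutoff (e - (e + e)) = 0.
  rewrite /cutoff /sqdist (_ : e - (e + e) - e = - (e *+ 2)); last first.
    by rewrite mulr2n opprD addrA subrr sub0r.
  by rewrite dotN dotn flat_powR_le0// subr_le0 ler_peMl ?(ltW e_gt0)// -natrX ler1n.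
rewrite /spectrum /component c1 c2 !mul0r !addr0.
have wE a j : pweight a j e = flat_powR a (j.+1%:R ^+ 2 * dot e e).
  by rewrite /pweight /sqdist opprK -mulrS dotn.
rewrite !wE mulf_neq0//.
  have dot0 : @dot R d 0 0 = 0 by apply: (@big1) => i _; rewrite mxE mul0r.
  by rewrite /cutoff /sqdist subrr dot0 subr0 ?gt_eqF ?flat_powR_gt0.
have pos (j : nat) : 0 < j.+1%:R ^+ 2 * dot e e by rewrite mulr_gt0// exprn_gt0// ltr0n.
rewrite mulf_neq0//; first by rewrite gt_eqF// flat_powR_gt0.
have s0 : s != 0 by rewrite gt_eqF.
rewrite !(flat_powRM (ltW (pos _)) s0).
set w1 := flat_powR 0 (2%:R ^+ 2 * _); set w2 := flat_powR 0 (3%:R ^+ 2 * _).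
(* At e the last factor is p_2 - p_1 = (3 |e|)^(2s) - (2 |e|)^(2s), positive because s > 0. *)
rewrite (_ : _ - _ = w1 * w2 * ((3%:R ^+ 2 * dot e e) `^ s - (2%:R ^+ 2 * dot e e) `^ s)); last by ring.
rewrite gt_eqF// mulr_gt0 ?mulr_gt0 ?flat_powR_gt0// subr_gt0.
apply: gt0_ltr_powR => //; rewrite ?nnegrE ?(ltW (pos _))//; by rewrite ltr_pM2r// -!natrX ltr_nat.
Qed.

End construction.

Section lattice_duality.
Context {R : realType} {d : nat}.

Lemma dotE (x y : 'cV[R]_d) : dot x y = (x^T *m y) ord0 ord0.
Proof. by rewrite mxE; apply: eq_bigr => i _; rewrite mxE. Qed.

Lemma dual_lattice_vector (M : 'M[R]_d) (i : 'I_d) (k : 'cV[int]_d) : M \in unitmx ->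
  dot ((invmx M)^T *m delta_mx i ord0) (M *m map_mx intr k) = (k i ord0)%:~R.
Proof.
move=> MU; rewrite dotE trmx_mul trmxK -mulmxA mulKmx// trmx_delta.
by rewrite -rowE !mxE.
Qed.

End lattice_duality.

Local Open Scope complex_scope.

Theorem theorem1p3 (R : realType) (d : nat) (s : R) (M : 'M[R]_d)
  (d_ge1 : (1 <= d)%N) (s_gt0 : 0 < s) (M_GL : M \in unitmx) :
  frac_laplacian_nonuniqueness_pair s bandlimited_schwartz
    (lattice M) (lattice M).
Proof.
pose i0 := Ordinal d_ge1.
pose e : 'cV[R]_d := (invmx M)^T *m delta_mx i0 ord0.
have eM k : dot e (M *m map_mx intr k) = (k i0 ord0)%:~R := dual_lattice_vector i0 k M_GL.
have e_gt0 : 0 < dot e e.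
  rewrite lt_def sumr_ge0 ?andbT; last by move=> i _; rewrite -expr2 sqr_ge0.
  apply/negP => /eqP e0.
  have eE : e = 0.
    apply/colP => i; rewrite [RHS]mxE; apply/eqP.
    have /psumr_eq0P : forall j : 'I_d, true -> 0 <= e j ord0 * e j ord0.
      by move=> j _; rewrite -expr2 sqr_ge0.
    by move=> /(_ e0 i isT)/eqP; rewrite mulf_eq0 orbb.
  (* The pairing of e with the lattice vector M e_(i0) is 1, so e cannot be 0. *)
  have := eM (delta_mx i0 ord0).
  rewrite eE /dot big1 => [|i _]; last by rewrite mxE mul0r.
  by rewrite mxE !eqxx => /esym/eqP; rewrite oner_eq0.
have tF a := test_function_spectrum s e a.
pose f := inverse_fourier (spectrum s e 0).
pose u := inverse_fourier (spectrum s e s).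
(* The case a = 0 is the vanishing of f, and a = s that of its fractional Laplacian. *)
have zero a x : a = 0 \/ a = s -> lattice M x -> inverse_fourier (spectrum s e a) x = 0.
  move=> a0s [k _ <-]; rewrite /inverse_fourier.
  have tC j1 j2 j3 := test_function_component s e a j1 j2 j3.
  have Z (tr : R -> R) : measurable_fun setT tr -> (forall y, `|tr y| <= 1) ->
      (forall b, tr (b + 2 * pi) = tr b) ->
      osc_integral tr (spectrum s e a) (M *m map_mx intr k) = 0.
    move=> mtr tr1 tr2pi.
    exact: (osc_integral_cancel mtr tr1 tr2pi (tC _ _ _) (tC _ _ _) (tC _ _ _)
      (fun y => component_sum e y a0s) (eM k)).
  rewrite (Z _ (@measurable_cosR R) (@norm_cos_le1 R)); last first.
    by move=> b; rewrite mulr_natl cosD2pi.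
  rewrite (Z _ (@measurable_sinR R) (@norm_sin_le1 R))// => b.
  by rewrite mulr_natl sinD2pi.
have fourier_f : fourier f = fun xi => (spectrum s e 0 xi)%:C.
  by apply/funext => xi; exact: fourier_inverse_fourier.
exists f, u; split.
- split; first exact: schwartz_inverse_fourier.
  rewrite fourier_f; split.
    split; apply: elementary_smooth; last exact: elementary_cst.
    by case: (tF 0).
  rewrite (_ : [set x | _] = [set x | spectrum s e 0 x != 0]); last first.
    by apply/seteqP; split => x /=; apply: contra => /eqP; [move=> ->|move=> /= [->]].
  exact: compact_support_test_function.
(* If f were 0, its transform would vanish at e, against [spectrum_neq0]. *)
- move=> f0; have := congr1 (fun g => g e) fourier_f.
  rewrite f0 /fourier /integral_Rd => /(congr1 (@complex.Re R))/= F0.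
  have /negP := spectrum_neq0 s_gt0 e_gt0; apply; rewrite -F0.
  rewrite /Rintegral (eq_integral (cst 0%E)) ?integral0// => t _.
  by rewrite /= !mul0r ?subr0 ?subrr.
- split; [exact: smooth_inverse_fourier|exact: integrable_inverse_fourier|].
  move=> xi; rewrite !fourier_inverse_fourier// spectrum_powR//.
  by rewrite rmorphM.
- by move=> x; apply: zero; left.
- by move=> x; apply: zero; right.
Qed.
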